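(* Let $P\in\mathbb R^{n\times n}$ be symmetric positive definite, let $f$ and $g_1,\dots,g_k$ be smooth vector fields on $\mathbb R^n$, $G=(g_1,\dots,g_k)$, and $x_0\in\mathbb R^n$. Consider the infinite-horizon functional $J_0^\infty(u)=\int_0^{+\infty}x_u(t)'Px_u(t)\,dt$ along trajectories $x_u$ of $\dot x=f(x)+G(x)u$, $x(0)=x_0$. If the system is locally stabilizable of order $\alpha>\frac1p$ with $p\in[1,2[$, then $$\lim_{\varepsilon\to0^+}\ \inf_{u\in L_p^k[0,+\infty[}\Big(J_0^\infty(u)+\varepsilon\|u\|^p_{L_p^k[0,+\infty[}\Big)=\inf_{u\in L_{1,loc}^k}J_0^\infty(u).$$ For $p\in[2,+\infty[$ the equality holds provided the system is locally stabilizable of order $\alpha>\frac12$.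
   Context: The functional $J_0^\infty(u)$ is set equal to $+\infty$ for any control $u$ for which the control system has no solution on $[0,+\infty[$. $L_{1,loc}^k$ denotes the locally integrable functions $[0,+\infty[\to\mathbb R^k$. The control-affine system $\dot x=f(x)+G(x)u$ is said to be locally stabilizable of order $\alpha$ if there exist a Lipschitzian feedback $\bar u(x)$ and a constant $C<+\infty$ such that $\bar u(0)=0$ and $|x(t;x_0)|\le C|x_0|(t+1)^{-\alpha}$ (for $t\ge0$) holds for every $x_0$ in some neighborhood of the origin, where $x(\cdot;x_0)$ is the trajectory of $\dot x=f(x)+G(x)\bar u(x)$, $x(0)=x_0$. *)

(* Defs.v *)
From HB Require Import structures.
From mathcomp Require Import all_boot all_order all_algebra.
From mathcomp Require Import all_classical all_reals all_analysis.
Set Implicit Arguments.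
Unset Strict Implicit.
Unset Printing Implicit Defensive.
Import Order.TTheory GRing.Theory Num.Theory.
Import numFieldNormedType.Exports.
Local Open Scope classical_set_scope.
Local Open Scope ring_scope.

(* The library norm `|x| on column vectors is the sup norm. *)
Definition enorm (R : realType) (n : nat) (x : 'cV[R]_n) : R :=
  Num.sqrt (\sum_i x i 0 ^+ 2).

Definition quad_form (R : realType) (n : nat) (P : 'M[R]_n) (x : 'cV[R]_n) : R :=
  (x^T *m P *m x) 0 0.

Definition sym_posdef (R : realType) (n : nat) (P : 'M[R]_n) : Prop :=
  P^T = P /\ forall x : 'cV[R]_n, x != 0 -> 0 < quad_form P x.

Fixpoint Ck_field (R : realType) (n m : nat) (f : 'cV[R]_n -> 'cV[R]_n) : Prop :=
  match m with
  | 0%N => continuous f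
  | m'.+1 => (forall x, differentiable f x) /\
             (forall v : 'cV[R]_n, Ck_field m' (fun x => 'D_v f x))
  end.

Definition smooth_field (R : realType) (n : nat) (f : 'cV[R]_n -> 'cV[R]_n) : Prop :=
  forall m : nat, Ck_field m f.

Definition control_mx (R : realType) (n k : nat)
    (g : 'I_k -> 'cV[R]_n -> 'cV[R]_n) (x : 'cV[R]_n) : 'M[R]_(n, k) :=
  \matrix_(i < n, j < k) g j x i 0.

(* Caratheodory solutions on [0, +oo[ of x' = F(t, x), x(0) = x0, i.e. locally
   absolutely continuous solutions of the equation a.e., in integral form;
   the values of x at negative times are irrelevant. *)
Definition is_solution (R : realType) (n : nat)
    (F : R -> 'cV[R]_n -> 'cV[R]_n) (x0 : 'cV[R]_n) (x : R -> 'cV[R]_n) : Prop :=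
  forall t : R, 0 <= t -> forall i : 'I_n,
    (@lebesgue_measure R).-integrable `[0, t] (fun s => (F s (x s) i 0)%:E) /\
    x t i 0 = x0 i 0 + \int[@lebesgue_measure R]_(s in `[0, t]) (F s (x s) i 0).

Definition is_trajectory (R : realType) (n k : nat)
    (f : 'cV[R]_n -> 'cV[R]_n) (g : 'I_k -> 'cV[R]_n -> 'cV[R]_n)
    (x0 : 'cV[R]_n) (u : R -> 'cV[R]_k) (x : R -> 'cV[R]_n) : Prop :=
  is_solution (fun t y => f y + control_mx g y *m u t) x0 x.

(* For smooth f, g and locally integrable u the trajectory is unique on
   [0, +oo[, so the choice made by cid is immaterial. *)
Definition cost (R : realType) (n k : nat) (P : 'M[R]_n)
    (f : 'cV[R]_n -> 'cV[R]_n) (g : 'I_k -> 'cV[R]_n -> 'cV[R]_n)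
    (x0 : 'cV[R]_n) (u : R -> 'cV[R]_k) : \bar R :=
  match pselect (exists x, is_trajectory f g x0 u x) with
  | left ex =>
      (\int[@lebesgue_measure R]_(t in `[0%R, +oo[)
        (quad_form P (projT1 (cid ex) t))%:E)%E
  | right _ => +oo%E
  end.

Definition L1loc (R : realType) (k : nat) : set (R -> 'cV[R]_k) :=
  [set u : R -> 'cV[R]_k | forall T : R, 0 <= T -> forall j : 'I_k,
     (@lebesgue_measure R).-integrable `[0, T] (fun t => (u t j 0)%:E)].

Definition Lp_norm (R : realType) (k : nat) (p : R) (u : R -> 'cV[R]_k) : \bar R :=
  Lnorm (@lebesgue_measure R) p%:E
    ((fun t => (enorm (u t))%:E) \_ `[0%R, +oo[).

Definition Lp (R : realType) (k : nat) (p : R) : set (R -> 'cV[R]_k) :=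
  [set u : R -> 'cV[R]_k | (forall j : 'I_k,
              measurable_fun (`[0, +oo[ : set R) (fun t => u t j 0)) /\
           (Lp_norm p u < +oo)%E].

Definition locally_stabilizable (R : realType) (n k : nat)
    (f : 'cV[R]_n -> 'cV[R]_n) (g : 'I_k -> 'cV[R]_n -> 'cV[R]_n)
    (alpha : R) : Prop :=
  exists (ubar : 'cV[R]_n -> 'cV[R]_k) (C : R),
    [/\ [lipschitz ubar x | x in [set: 'cV[R]_n]],
        ubar 0 = 0 &
        \forall x0 \near (0 : 'cV[R]_n), exists x : R -> 'cV[R]_n,
          is_solution (fun _ y => f y + control_mx g y *m ubar y) x0 x /\
          forall t : R, 0 <= t ->
            enorm (x t) <= C * enorm x0 * (t + 1) `^ (- alpha)].

(* Main.v *)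
(* The controls in Lp are locally integrable, so each regularized infimum is at least
   the infimum of J; it remains to approximate the cost of a locally integrable
   control u by costs of controls in Lp.  If the cost of the trajectory x of u is
   finite then x(T) is arbitrarily small for some T.  On [0, T] the control u is
   truncated: Picard iteration for the truncated control, started at x itself and
   measured in an exponentially weighted norm adapted to u, converges to a trajectory
   uniformly close to x.  After T one follows the trajectory of the stabilizing
   feedback.  As it decays like (t + 1)^-alpha with 2 alpha > 1 and p alpha > 1, this
   part of the control is in Lp and the tail of the cost is quadratically small in
   the state at time T. *)
Require Import Defs.
From HB Require Import structures.
From mathcomp Require Import all_boot all_order all_algebra.
From mathcomp Require Import all_classical all_reals all_analysis.
From mathcomp Require Import measurable_realfun ring lra.
Import Order.TTheory GRing.Theory Num.Theory.
Import numFieldNormedType.Exports.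
Local Open Scope classical_set_scope.
Local Open Scope ring_scope.
Set Implicit Arguments.
Unset Strict Implicit.
Unset Printing Implicit Defensive.

(** Three obstacles shape the proof. A locally integrable control need not have a finite [Lp] norm
    even on [0, T], hence the truncation. The fields are only locally Lipschitz, so a trajectory of
    the truncated control might a priori blow up before T; starting the iteration at [x] confines
    all iterates to a thin tube around [x], and existence up to T comes out together with closeness.
    Finally, the Lipschitz constant at time t, L (1 + sum |u_j(t)|), is integrable but not bounded,
    so the rate l of the weight exp(l t) has to be fitted to it. The integral operator then halves
    distances, and the same halving gives uniqueness, which allows the cost of the glued control to
    be computed along the glued trajectory.

    Since truncation only decreases |u_j|, the rate l depends on u alone and the truncation levels
    can be chosen after it. The other choices come in the order: admissible size of the state at the
    switch, switching time T, closeness on [0, T]. *)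

Section AbstractIntegrals.
Context d (X : measurableType d) (R : realType).
Variable mu : {measure set X -> \bar R}.
Implicit Types f g : X -> R.

Lemma norm_Rintegral_le (D : set X) f g : measurable D ->
  mu.-integrable D (EFin \o f) -> mu.-integrable D (EFin \o g) ->
  (forall s, D s -> `|f s| <= g s) ->
  `|\int[mu]_(s in D) f s| <= \int[mu]_(s in D) g s.
Proof.
move=> mD fi gi fg; apply: le_trans (le_normr_Rintegral mD fi) _.
by apply: le_Rintegral => //; exact: integrable_norm.
Qed.

Lemma Rintegral_subset (A B : set X) f : measurable A -> measurable B ->
  A `<=` B -> mu.-integrable B (EFin \o f) -> (forall s, B s -> 0 <= f s) ->
  \int[mu]_(s in A) f s <= \int[mu]_(s in B) f s.
Proof.
move=> mA mB AB fi f0; apply: fine_le.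
- by apply: integrable_fin_num => //; exact: integrableS fi.
- exact: integrable_fin_num.
- apply: ge0_subset_integral => //.
  exact: (measurable_int mu).
Qed.

Lemma integrable_dominated (D : set X) f g : measurable D ->
  measurable_fun D f -> mu.-integrable D (EFin \o g) ->
  (forall s, D s -> `|f s| <= g s) -> mu.-integrable D (EFin \o f).
Proof.
move=> mD mf gi fg; apply: (le_integrable mD _ _ gi).
  exact/measurable_EFinP.
move=> s Ds /=; rewrite lee_fin; apply: le_trans (fg s Ds) _.
exact: ler_norm.
Qed.

(** Dominated convergence: the excess vanishes at each point once N exceeds |f s|, and it is
    dominated by |f|. *)
Lemma truncation_small (D : set X) f (e : R) : measurable D ->
  mu.-integrable D (EFin \o f) -> 0 < e ->
  exists N : nat, \int[mu]_(s in D) Num.max (`|f s| - N%:R) 0 <= e.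
Proof.
move=> mD fi e0.
have mf : measurable_fun D f by apply/measurable_EFinP; exact: measurable_int fi.
pose h (N : nat) (s : X) : \bar R := (Num.max (`|f s| - N%:R) 0)%:E.
have mh N : measurable_fun D (h N).
  apply/measurable_EFinP; apply: measurable_maxr => //.
  by apply: measurable_funB => //; exact: measurableT_comp.
have [] := @dominated_convergence _ X R mu D mD h (cst 0%E)
  (EFin \o (Num.norm \o f)) mh.
- by [].
- apply: aeW => s Ds; apply: cvg_near_cst; near=> N.
  rewrite /h; congr EFin; apply/max_idPr; rewrite subr_le0.
  by near: N; exact: nbhs_infty_ger.
- exact: integrable_norm.
- apply: aeW => s N Ds; rewrite /h /= lee_fin ger0_norm; last first.
    by rewrite le_max lexx orbT.
  by rewrite ge_max normr_ge0 andbT gerBl.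
rewrite integral0 => _ _ /fine_cvgP[hfin /cvgrPdist_le /(_ e e0)].
move=> [N _ /(_ N (leqnn N))] /= hN; exists N.
move: hN; rewrite sub0r normrN; exact: le_trans (ler_norm _).
Unshelve. all: by end_near. Qed.

Lemma integrable_scale (D : set X) (k : R) f : measurable D ->
  mu.-integrable D (EFin \o f) -> mu.-integrable D (EFin \o (fun s => k * f s)).
Proof.
move=> mD /(integrableZl mD k).
by apply: eq_integrable => // s _ /=; rewrite EFinM.
Qed.

Lemma integrable_add (D : set X) f g : measurable D ->
  mu.-integrable D (EFin \o f) -> mu.-integrable D (EFin \o g) ->
  mu.-integrable D (EFin \o (fun s => f s + g s)).
Proof.
move=> mD fi gi; have := integrableD mD fi gi.
by apply: eq_integrable => // s _ /=; rewrite EFinD.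
Qed.

Lemma integrable_sub (D : set X) f g : measurable D ->
  mu.-integrable D (EFin \o f) -> mu.-integrable D (EFin \o g) ->
  mu.-integrable D (EFin \o (fun s => f s - g s)).
Proof.
move=> mD fi gi; have := integrableB mD fi gi.
by apply: eq_integrable => // s _ /=; rewrite EFinB.
Qed.

Lemma integrable_bigsum (I : finType) (D : set X) (h : I -> X -> R) :
  measurable D -> (forall j, mu.-integrable D (EFin \o h j)) ->
  mu.-integrable D (EFin \o (fun s => \sum_j h j s)).
Proof.
move=> mD hi.
have := integrable_sum mD (index_enum I) (P := xpredT)
  (h := fun j => EFin \o h j) (fun j _ => hi j).
by apply: eq_integrable => // s _ /=; rewrite sumEFin.
Qed.

Lemma Rintegral_sum (I : finType) (D : set X) (h : I -> X -> R) :
  measurable D -> (forall j, mu.-integrable D (EFin \o h j)) ->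
  \int[mu]_(s in D) (\sum_j h j s) = \sum_j \int[mu]_(s in D) h j s.
Proof.
move=> mD hi; rewrite /Rintegral.
under eq_integral do rewrite -sumEFin.
rewrite (integral_sum mD (fun j => hi j)) -sum_fine// => j _.
exact: integrable_fin_num.
Qed.

End AbstractIntegrals.

(** * Integrals on the line: exponential weights, translations, power tails *)

Section RealIntegrals.
Variable R : realType.
Notation mu := (@lebesgue_measure R).
Implicit Types (f g a : R -> R) (T t : R).

Lemma integrable_cst_itv T t (c : R) : mu.-integrable `[T, t] (EFin \o cst c).
Proof.
apply: continuous_compact_integrable; first exact: segment_compact.
by apply: continuous_subspaceT => x; exact: cst_continuous.
Qed.

Lemma integral_expR_le (l t : R) : 0 < l -> 0 <= t ->
  \int[mu]_(s in `[0, t]) (l * expR (l * s)) <= expR (l * t).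
Proof.
move=> l0; rewrite le_eqVlt => /predU1P[<-|t0].
  by rewrite set_itv1 Rintegral_set1 expR_ge0.
have dF (x : R) : is_derive x 1 (fun s : R => expR (l * s)) (l * expR (l * x)).
  by apply: is_derive_eq; rewrite /GRing.scale /= mulr1; ring.
have cF : continuous (fun s : R => expR (l * s)).
  by move=> x; apply: continuous_comp; [exact: mulrl_continuous|exact: continuous_expR].
have -> : \int[mu]_(s in `[0, t]) (l * expR (l * s)) =
    expR (l * t) - expR (l * 0).
  rewrite /Rintegral (@continuous_FTC2 _ _ (fun s : R => expR (l * s))) //.
  - by apply: continuous_subspaceT => x; apply: cvgM; [exact: cvg_cst|exact: cF].
  - split => [x _||]; first by case: (dF x).
      exact/cvg_at_right_filter/cF.
    exact/cvg_at_left_filter/cF.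
  - by move=> x _; rewrite derive1E derive_val.
by rewrite lerBlDr lerDl expR_ge0.
Qed.

(** For nonnegative [a], the map sending z to the integral of a z over [0, t] contracts by 1/2 in
    the Bielecki norm sup |z(t)| exp(-l t). The condition l >= 0 keeps the weight nondecreasing and
    at least 1. *)
Definition exp_weight T a (l : R) : Prop := 0 <= l /\ forall t, 0 <= t <= T ->
  mu.-integrable `[0, t] (EFin \o (fun s => a s * expR (l * s))) /\
  \int[mu]_(s in `[0, t]) (a s * expR (l * s)) <= 2^-1 * expR (l * t).

(* Truncate a at a level N leaving a remainder of integral at most 1/4: the bounded
   part is absorbed by the weight for l = 4 (N + 1), the remainder for any l >= 0. *)
Lemma expR_weight T a : 0 <= T ->
  mu.-integrable `[0, T] (EFin \o a) -> (forall s, 0 <= s <= T -> 0 <= a s) ->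
  exists l : R, exp_weight T a l.
Proof.
move=> T0 ai a0.
have e4 : (0 : R) < 4^-1 by lra.
have [//|N hN] := truncation_small _ ai e4.
pose l : R := 4 * (N%:R + 1).
have N0 : (0 : R) <= N%:R by [].
have l0 : 0 < l by rewrite /l; lra.
exists l; split; first exact: ltW.
move=> t /andP[t0 tT].
have sub : `[0, t] `<=` `[0, T].
  by apply: subset_itvl; rewrite bnd_simp.
have ait : mu.-integrable `[0, t] (EFin \o a) by exact: integrableS ai.
have cE : continuous (fun s : R => expR (l * s)).
  by move=> x; apply: continuous_comp; [exact: mulrl_continuous|exact: continuous_expR].
have cEi : mu.-integrable `[0, t] (EFin \o (fun s => expR (l * s))).
  apply: continuous_compact_integrable; first exact: segment_compact.
  exact: continuous_subspaceT.
have mE : measurable_fun `[0, t] (fun s => expR (l * s)).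
  by apply/measurable_EFinP; exact: measurable_int cEi.
have ma : measurable_fun `[0, t] a.
  by apply/measurable_EFinP; exact: measurable_int ait.
have aei : mu.-integrable `[0, t] (EFin \o (fun s => a s * expR (l * s))).
  apply: (integrable_dominated (mu := mu) (g := fun s => expR (l * t) * a s)) => //.
  - exact: measurable_funM.
  - exact: integrable_scale.
  move=> s; rewrite /= in_itv/= => /andP[s0 st].
  have as0 : 0 <= a s by apply: a0; rewrite s0 (le_trans st).
  rewrite ger0_norm ?mulr_ge0 ?expR_ge0// mulrC ler_wpM2r// ler_expR.
  by rewrite ler_wpM2l// ltW.
split=> //.
pose r s := Num.max (`|a s| - N%:R) 0.
have ri : mu.-integrable `[0, T] (EFin \o r).
  apply: (integrable_dominated (mu := mu) (g := Num.norm \o a)) => //.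
  - apply: measurable_maxr => //; apply: measurable_funB => //.
    apply: measurableT_comp => //.
    by apply/measurable_EFinP; exact: measurable_int ai.
  - exact: integrable_norm.
  move=> s _; rewrite /r ger0_norm; last by rewrite le_max lexx orbT.
  by rewrite /= ge_max normr_ge0 andbT gerBl.
have rit : mu.-integrable `[0, t] (EFin \o r) by exact: integrableS ri.
apply: (@le_trans _ _ (\int[mu]_(s in `[0, t])
    (4^-1 * (l * expR (l * s)) + expR (l * t) * r s))).
  apply: le_Rintegral => //.
    by apply: integrable_add => //; do ?apply: integrable_scale.
  move=> s; rewrite /= in_itv/= => /andP[s0 st].
  have as0 : 0 <= a s by apply: a0; rewrite s0 (le_trans st).
  have es : expR (l * s) <= expR (l * t).
    by rewrite ler_expR ler_wpM2l// ltW.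
  have e0 := expR_ge0 (l * s).
  have r0 : 0 <= r s by rewrite /r le_max lexx orbT.
  have ar : a s - N%:R <= r s by rewrite /r ger0_norm // le_max lexx.
  rewrite /l; set E := expR _ in es e0 *; set E' := expR _ in es *.
  nra.
rewrite RintegralD//; last 2 first.
- by apply: integrable_scale => //; apply: integrable_scale.
- exact: integrable_scale.
rewrite !RintegralZl//; last exact: integrable_scale.
have rt : \int[mu]_(s in `[0, t]) r s <= 4^-1.
  apply: le_trans hN; apply: Rintegral_subset => //.
  by move=> s _; rewrite /r le_max lexx orbT.
have := integral_expR_le l0 t0; rewrite RintegralZl//.
move: (expR_ge0 (l * t)) rt; move: (expR _) (\int[mu]_(s in _) expR _) (\int[mu]_(s in _) r _).
by move: l {l0 cE cEi mE aei} => L E I1 I2; nra.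
Qed.

(** The pushforward under a translation gives each half-open interval its length, and this
    determines the measure. *)
Lemma lebesgue_measure_shift (c : R) (A : set (measurableTypeR R)) : measurable A ->
  pushforward mu ((fun s => s - c) : measurableTypeR R -> measurableTypeR R) A = mu A.
Proof.
move=> mA; have mphi : measurable_fun setT
   ((fun s => s - c) : measurableTypeR R -> measurableTypeR R).
  by apply: measurable_funB.
pose phi : {mfun measurableTypeR R >-> measurableTypeR R} :=
  HB.pack (fun s => s - c) (isMeasurableFun.Build _ _ _ _ _ mphi).
apply/esym; apply: (@lebesgue_measure_unique R (pushforward mu phi)) => //=.
move=> _ [[a b]] _ <-.
rewrite /pushforward/=.
have -> : ((fun s => s - c) @^-1` `]a, b])%classic = `](a + c), (b + c)]%classic.
  by apply/seteqP; split => x /=; rewrite !in_itv/= ltrBrDr lerBlDr.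
rewrite !lebesgue_measure_itv/= !lte_fin ltrD2r.
by case: ifP => // _; rewrite -!EFinB; congr EFin; ring.
Qed.

Lemma integral_shift (c a b : R) (h : R -> R) :
  mu.-integrable `[a, b] (EFin \o h) ->
  mu.-integrable `[a + c, b + c] (EFin \o (fun s => h (s - c))) /\
  \int[mu]_(s in `[a + c, b + c]) h (s - c) = \int[mu]_(s in `[a, b]) h s.
Proof.
move=> hi.
pose phi : measurableTypeR R -> measurableTypeR R := fun s => s - c.
have mphi : measurable_fun setT phi by apply: measurable_funB.
pose D : set (measurableTypeR R) := `[a, b]%classic.
pose D' : set (measurableTypeR R) := `[a + c, b + c]%classic.
have DD' : phi @^-1` D = D'.
  by apply/seteqP; split => x; rewrite /phi /D /D' /= !in_itv/= lerBrDr lerBlDr.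
have mD : measurable D by exact: measurable_itv.
have mD' : measurable D' by exact: measurable_itv.
(* The pushforward formula takes a function measurable on the whole line, while [h] is controlled on
   [a, b] only; hence the extension by zero. *)
pose g : measurableTypeR R -> R := h \_ D.
have gi : mu.-integrable setT (EFin \o g).
  by rewrite -restrict_EFin; apply/integrable_restrict => //; rewrite setTI.
have mg : measurable_fun setT (EFin \o g) by exact: measurable_int gi.
have meq (k : measurableTypeR R -> \bar R) :
    (\int[pushforward mu phi]_(y in D) k y = \int[mu]_(y in D) k y)%E.
  by apply: eq_measure_integral => A mA _; exact: lebesgue_measure_shift.
have gi' : mu.-integrable D' ((EFin \o g) \o phi).
  apply/integrableP; split.
    by apply: measurable_funTS; exact: measurableT_comp.
  rewrite -DD' -(@ge0_integral_pushforward _ _ _ _ _ phi mphi mu D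
    (abse \o (EFin \o g)))//; last first.
    by move=> x _; exact: abse_ge0.
    by apply: measurable_funTS; exact: measurableT_comp.
  rewrite meq.
  have : mu.-integrable D (EFin \o g) by exact: integrableS gi.
  by move=> /integrableP[].
have geq s : D' s -> g (phi s) = h (s - c).
  by rewrite -DD' => Ds; rewrite /g patchE mem_set.
split.
  by apply: eq_integrable gi' => // s; rewrite inE => Ds /=; rewrite geq.
have := @integral_pushforward _ _ _ _ R phi mphi mu D _ mg.
rewrite DD' meq => /(_ gi' mD) E.
rewrite /Rintegral; congr fine.
transitivity (\int[mu]_(x in D') ((EFin \o g) \o phi) x)%E.
  by apply: eq_integral => s; rewrite inE => Ds /=; rewrite geq.
rewrite -E; apply: eq_integral => s Ds.
by rewrite /= /g patchE Ds.
Qed.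

(** The antiderivative -(b - 1)^-1 (t - T + 1)^(1 - b) equals -(b - 1)^-1 at T and, as b > 1, tends
    to 0 at infinity. *)
Lemma powR_tail_integral (b T : R) : 1 < b ->
  (\int[mu]_(t in `[T, +oo[) ((t - T + 1) `^ (- b))%:E = ((b - 1)^-1)%:E)%E.
Proof.
move=> b1.
pose F t : R := - (b - 1)^-1 * (t - T + 1) `^ (1 - b).
have b10 : b - 1 != 0 by rewrite gt_eqF// subr_gt0.
have dG (r : R) (x : R) : T - 1 < x ->
    is_derive x 1 (fun t : R => (t - T + 1) `^ r) (r * (x - T + 1) `^ (r - 1)).
  move=> Tx; have x0 : 0 < x - T + 1 by lra.
  have := is_derive1_powR r x0 => dp.
  have ds : is_derive x 1 (fun t : R => t - T + 1) 1.
    by apply: is_derive_eq; rewrite ?oppr0 ?addr0.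
  have := is_derive1_comp (f := fun y : R => y `^ r) (g := fun t : R => t - T + 1) dp ds.
  by rewrite mulr1.
have dF (x : R) : T - 1 < x -> is_derive x 1 F ((x - T + 1) `^ (- b)).
  move=> Tx; have := dG (1 - b) x Tx => d1.
  have -> : (x - T + 1) `^ (- b) = - (b - 1)^-1 * ((1 - b) * (x - T + 1) `^ (1 - b - 1)).
    rewrite mulrA (_ : - (b - 1)^-1 * (1 - b) = 1); last by field.
    by rewrite mul1r; congr powR; ring.
  exact: is_deriveZ.
have cG r (x : R) : T - 1 < x -> {for x, continuous (fun t : R => (t - T + 1) `^ r)}.
  move=> Tx; apply/differentiable_continuous/derivable1_diffP.
  by have [] := dG r x Tx.
have cF (x : R) : T - 1 < x -> {for x, continuous F}.
  move=> Tx; apply/differentiable_continuous/derivable1_diffP.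
  by have [] := dF x Tx.
rewrite (@ge0_continuous_FTC2y _ _ F T 0).
  by rewrite -EFinB /F sub0r subrr add0r powR1 mulr1 opprK.
- by move=> x _; exact: powR_ge0.
- apply: continuous_in_subspaceT => x; rewrite inE/= in_itv/= andbT => Tx.
  by apply: cG; lra.
- rewrite -[X in _ --> X](mulr0 (- (b - 1)^-1)); apply: cvgM; first exact: cvg_cst.
  have b0 : 0 < b - 1 by lra.
  apply/cvgrPdist_le => e e0.
  near=> t.
  have t0 : 0 < t - T + 1.
    have : T < t by near: t; apply: nbhs_pinfty_gt; rewrite num_real.
    lra.
  rewrite sub0r normrN ger0_norm ?powR_ge0// (_ : 1 - b = - (b - 1)); last by ring.
  rewrite powRN.
  rewrite -(invrK e) lef_pV2 ?posrE ?invr_gt0 ?powR_gt0//.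
  (* The threshold is the base whose power of exponent b - 1 is exactly 1/e. *)
  have tE : e^-1 `^ (b - 1)^-1 <= t - T + 1.
    have : e^-1 `^ (b - 1)^-1 + T < t.
      by near: t; apply: nbhs_pinfty_gt; rewrite num_real.
    lra.
  have <- : (e^-1 `^ (b - 1)^-1) `^ (b - 1) = e^-1.
    by rewrite -powRrM mulVf// powRr1// invr_ge0 ltW.
  by apply: ge0_ler_powR => //; rewrite ?nnegrE ?powR_ge0// ltW.
- by move=> x Tx; have [] := dF x _; [lra|].
- by apply: cvg_at_right_filter; apply: cF; lra.
- move=> x; rewrite in_itv/= andbT => Tx; rewrite derive1E.
  have Tx1 : T - 1 < x by lra.
  by have [_ ->] := dF x Tx1.
Unshelve. all: by end_near. Qed.

End RealIntegrals.

(** * Column vectors: sup norm, continuity and measurability by coordinates *)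

Section ColumnVectors.
Variables (R : realType) (n : nat).
Implicit Types x y : 'cV[R]_n.

Lemma coord_le_norm x i : `|x i 0| <= `|x|.
Proof.
rewrite [leRHS]/Num.norm /= mx_normrE; apply/bigmax_geP; right => /=.
by exists (i, 0).
Qed.

Lemma norm_le_coord x (e : R) : 0 <= e -> (forall i, `|x i 0| <= e) -> `|x| <= e.
Proof.
move=> e0 xe; rewrite [leLHS]/Num.norm /= mx_normrE.
by apply/bigmax_leP; split => // -[i j] _ /=; rewrite ord1.
Qed.

Lemma continuous_coords (S : topologicalType) (z : S -> 'cV[R]_n) :
  (forall i, continuous (fun t => z t i 0)) -> continuous z.
Proof.
move=> cz t; apply/cvgrPdist_le => e e0; near=> s.
apply: norm_le_coord; first exact: ltW.
move=> i; rewrite !mxE; move: i; near: s; apply: filter_forall => i.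
by have /cvgrPdist_le /(_ e e0) := cz i t.
Unshelve. all: by end_near. Qed.

Lemma continuous_coord (S : topologicalType) (z : S -> 'cV[R]_n) i :
  continuous z -> continuous (fun t => z t i 0).
Proof. move=> cz t; apply: (@continuous_comp _ _ _ z (fun M : 'cV[R]_n => M i 0)).
  exact: cz.
exact: coord_continuous. Qed.

Lemma measurable_continuous_comp (D : set R) (z : R -> 'cV[R]_n) (h : 'cV[R]_n -> R) :
  measurable D -> {within D, continuous z} -> continuous h ->
  measurable_fun D (h \o z).
Proof.
move=> mD cz ch; apply: subspace_continuous_measurable_fun => //.
by move=> t; apply: (@continuous_comp (subspace D) _ _ z h); [exact: cz|exact: ch].
Qed.

End ColumnVectors.

(** * Estimates that are halved at each iteration *)

Section Geometric.
Variable R : realType.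

(** Turns estimates halved at every iteration into equalities. A positive r would contradict the
    bound at any k > C / r, since 2^k >= k. *)
Lemma geometric_bound_le0 (r C : R) : (forall k : nat, r <= C * 2^-1 ^+ k) -> r <= 0.
Proof.
move=> h; rewrite leNgt; apply/negP => r0.
have C0 : 0 < C by have := h 0%N; rewrite expr0 mulr1; apply: lt_le_trans.
have := h (Num.bound (C / r)); apply/negP; rewrite -ltNge.
have hb : C / r < (Num.bound (C / r))%:R by apply: archi_boundP; rewrite ltW// divr_gt0.
have h2 : ((Num.bound (C / r))%:R : R) <= 2 ^+ (Num.bound (C / r)).
  by rewrite -natrX ler_nat ltnW// ltn_expl.
rewrite exprVn ltr_pdivrMr ?exprn_gt0// mulrC -ltr_pdivrMr//.
exact: lt_le_trans h2.
Qed.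

(** Nested intervals: the lower ends [v] increase, the upper ends [w] decrease, and the supremum of
    the lower ends lies in all of them. The radius is the sum of the geometric series of steps from
    k on. *)
Lemma geometric_cauchy (u : nat -> R) (M : R) :
  (forall k, `|u k.+1 - u k| <= M * 2^-1 ^+ k) ->
  exists L, forall k, `|u k - L| <= 2 * M * 2^-1 ^+ k.
Proof.
move=> hu.
have M0 : 0 <= M by have := hu 0%N; rewrite expr0 mulr1; apply: le_trans.
pose v k := u k - 2 * M * 2^-1 ^+ k.
pose w k := u k + 2 * M * 2^-1 ^+ k.
have vS k : v k <= v k.+1.
  by rewrite /v exprS; have := hu k; rewrite ler_norml => /andP[]; lra.
have wS k : w k.+1 <= w k.
  by rewrite /w exprS; have := hu k; rewrite ler_norml => /andP[]; lra.
have vw k m : v k <= w m.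
  have vm : {homo v : i j / (i <= j)%N >-> i <= j} by exact/nondecreasing_seqP.
  have wm : {homo w : i j / (i <= j)%N >-> j <= i} by exact/nonincreasing_seqP.
  apply: (@le_trans _ _ (v (maxn k m))); first by apply: vm; exact: leq_maxl.
  apply: (@le_trans _ _ (w (maxn k m))); last by apply: wm; exact: leq_maxr.
  rewrite /v /w; have : 0 <= 2 * M * 2^-1 ^+ maxn k m by rewrite !mulr_ge0 ?exprn_ge0.
  lra.
exists (sup (range v)) => k.
have h1 : v k <= sup (range v).
  by apply: ub_le_sup; [exists (w 0%N) => _ [j _ <-]|exists k].
have h2 : sup (range v) <= w k.
  by apply: ge_sup; [exists (v 0%N), 0%N|move=> _ [j _ <-]].
by rewrite ler_norml; move: h1 h2; rewrite /v /w => h1 h2; apply/andP; split; lra.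
Qed.

End Geometric.

(** * Integral equations on [0, T]: contraction, uniqueness, Picard iteration *)

Section IntegralEquations.
Variables (R : realType) (n : nat).
Notation mu := (@lebesgue_measure R).
Implicit Types (F : R -> 'cV[R]_n -> 'cV[R]_n) (x y z : R -> 'cV[R]_n).
Implicit Types (a : R -> R) (T t l c d : R).

(** Needed because the trajectory of the truncated control is constructed up to T only. *)
Definition solution_on T F (x0 : 'cV[R]_n) x : Prop :=
  forall t, 0 <= t <= T -> forall i : 'I_n,
    mu.-integrable `[0, t] (fun s => (F s (x s) i 0)%:E) /\
    x t i 0 = x0 i 0 + \int[mu]_(s in `[0, t]) (F s (x s) i 0).

Lemma is_solution_on F (x0 : 'cV[R]_n) x :
  is_solution F x0 x <-> forall T, solution_on T F x0 x.
Proof.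
split=> [xs T t /andP[t0 _]|xs t t0]; first exact: xs.
by apply: (xs t); rewrite t0 lexx.
Qed.

Lemma integral_continuous T (h : R -> R) : 0 <= T ->
  mu.-integrable `[0, T] (EFin \o h) ->
  {within `[0, T], continuous (fun t => \int[mu]_(s in `[0, t]) h s)}.
Proof. exact: parameterized_integral_continuous. Qed.

Lemma integral_eq_continuous T (x0 : 'cV[R]_n) x (h : R -> 'cV[R]_n) : 0 <= T ->
  (forall i, mu.-integrable `[0, T] (fun s => (h s i 0)%:E)) ->
  (forall t, 0 <= t <= T -> forall i,
     x t i 0 = x0 i 0 + \int[mu]_(s in `[0, t]) (h s i 0)) ->
  {within `[0, T], continuous x}.
Proof.
move=> T0 hi xE; apply: continuous_coords => i.
apply: (@subspace_eq_continuous _ _ _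
  (fun t => x0 i 0 + \int[mu]_(s in `[0, t]) (h s i 0))).
  by move=> t; rewrite inE /= in_itv/= => tT; rewrite xE.
move=> t; apply: cvgD; first exact: cvg_cst.
exact: (integral_continuous T0 (hi i)).
Qed.

Lemma solution_on_continuous T F (x0 : 'cV[R]_n) x : 0 <= T ->
  solution_on T F x0 x -> {within `[0, T], continuous x}.
Proof.
move=> T0 xs; apply: (@integral_eq_continuous _ x0 _ (fun s => F s (x s)) T0).
  by move=> i; case: (xs T _ i) => //; rewrite T0 lexx.
by move=> t tT i; case: (xs t tT i).
Qed.

Lemma within_continuous_bounded T x : {within `[0, T], continuous x} ->
  exists M : R, 0 <= M /\ forall t, 0 <= t <= T -> `|x t| <= M.
Proof.
move=> cx.
have : compact ((fun t => `|x t|) @` `[0, T]).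
  apply: continuous_compact; last exact: segment_compact.
  by move=> t; apply: continuous_comp; [exact: cx|exact: norm_continuous].
move=> /compact_bounded[M [Mr hM]].
have M1 : M < Num.max M 0 + 1 by rewrite ltr_pwDr// le_max lexx.
exists (Num.max M 0 + 1); split; first by rewrite addr_ge0// le_max lexx orbT.
move=> t tT; have := hM _ M1 `|x t|; rewrite /= normr_id; apply.
by exists t.
Qed.

(** The single estimate behind both uniqueness and Picard iteration: the integrand is at most c a(s)
    exp(l s), and [exp_weight] halves the bound on integration. *)
Lemma integral_contraction F T a l c y z i t : exp_weight T a l -> 0 <= t <= T ->
  (forall s, 0 <= s <= T -> 0 <= a s) ->
  mu.-integrable `[0, T] (fun s => (F s (y s) i 0)%:E) ->
  mu.-integrable `[0, T] (fun s => (F s (z s) i 0)%:E) ->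
  (forall s, 0 <= s <= T -> `|F s (y s) - F s (z s)| <= a s * `|y s - z s|) ->
  (forall s, 0 <= s <= T -> `|y s - z s| <= c * expR (l * s)) ->
  0 <= c ->
  `|\int[mu]_(s in `[0, t]) (F s (y s) i 0) -
    \int[mu]_(s in `[0, t]) (F s (z s) i 0)| <= c * (2^-1 * expR (l * t)).
Proof.
move=> [l0 wl] /[dup] tT /andP[t0 tleT] a0 yi zi Fyz yz c0.
have sub : `[0, t] `<=` `[0, T] by apply: subset_itvl; rewrite bnd_simp.
have [ai wt] := wl t tT.
have yit : mu.-integrable `[0, t] (EFin \o (fun s => F s (y s) i 0)) by exact: integrableS yi.
have zit : mu.-integrable `[0, t] (EFin \o (fun s => F s (z s) i 0)) by exact: integrableS zi.
rewrite -RintegralB//.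
apply: (@le_trans _ _ (\int[mu]_(s in `[0, t]) (c * (a s * expR (l * s))))).
  apply: norm_Rintegral_le => //.
  - exact: integrable_sub.
  - exact: integrable_scale.
  move=> s; rewrite /= in_itv/= => /andP[s0 st].
  have sT : 0 <= s <= T by rewrite s0 (le_trans st).
  have := coord_le_norm (F s (y s) - F s (z s)) i; rewrite !mxE => /le_trans; apply.
  apply: le_trans (Fyz s sT) _; rewrite mulrCA.
  by apply: ler_wpM2l; [exact: a0|exact: yz].
by rewrite RintegralZl//; apply: ler_wpM2l.
Qed.

(** Both solutions are continuous, hence bounded, so their distance is at most (Mx + My) exp(l t);
    each use of the equation halves this bound. *)
Lemma solution_on_unique F T a (x0 : 'cV[R]_n) x y : 0 <= T ->
  mu.-integrable `[0, T] (EFin \o a) -> (forall s, 0 <= s <= T -> 0 <= a s) ->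
  solution_on T F x0 x -> solution_on T F x0 y ->
  (forall s, 0 <= s <= T -> `|F s (x s) - F s (y s)| <= a s * `|x s - y s|) ->
  forall t, 0 <= t <= T -> x t = y t.
Proof.
move=> T0 ai a0 xs ys Fxy.
have [l wl] := expR_weight T0 ai a0.
have TT : 0 <= T <= T by rewrite T0 lexx.
have [Mx [Mx0 hMx]] := within_continuous_bounded (solution_on_continuous T0 xs).
have [My [My0 hMy]] := within_continuous_bounded (solution_on_continuous T0 ys).
have key k t : 0 <= t <= T -> `|x t - y t| <= (Mx + My) * 2^-1 ^+ k * expR (l * t).
  elim: k t => [|k IH] t tT.
    rewrite expr0 mulr1; apply: le_trans (ler_normB _ _) _.
    have e1 : 1 <= expR (l * t).
      by rewrite -expR0 ler_expR mulr_ge0//; [case: wl|case/andP: tT].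
    have := hMx t tT; have := hMy t tT; nra.
  have c0 : 0 <= (Mx + My) * 2^-1 ^+ k by rewrite mulr_ge0 ?exprn_ge0 ?addr_ge0.
  have b0 : 0 <= (Mx + My) * 2^-1 ^+ k.+1 * expR (l * t).
    by rewrite !mulr_ge0 ?exprn_ge0 ?addr_ge0 ?expR_ge0.
  apply: norm_le_coord => // i; rewrite !mxE.
  have [_ ->] := xs t tT i; have [_ ->] := ys t tT i.
  rewrite opprD addrACA subrr add0r.
  have := integral_contraction wl tT a0 (xs T TT i).1 (ys T TT i).1 Fxy IH c0.
  by move=> /le_trans; apply; rewrite exprSr !mulrA.
move=> t tT; apply/eqP; rewrite -subr_eq0 -normr_le0.
apply: (@geometric_bound_le0 _ _ ((Mx + My) * expR (l * t))) => k.
by have := key k t tT; rewrite mulrAC.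
Qed.

(* Picard iteration started at an approximate solution x: the iterates stay in the
   tube |y - x s| <= 2 d exp(l s), so F needs to be Lipschitz only there. *)
Lemma picard_perturbation F T a l d (x0 : 'cV[R]_n) x : 0 <= T ->
  exp_weight T a l -> (forall s, 0 <= s <= T -> 0 <= a s) -> 0 <= d ->
  {within `[0, T], continuous x} ->
  (forall s, 0 <= s <= T -> forall y z : 'cV[R]_n,
     `|y - x s| <= 2 * d * expR (l * s) -> `|z - x s| <= 2 * d * expR (l * s) ->
     `|F s y - F s z| <= a s * `|y - z|) ->
  (forall z, {within `[0, T], continuous z} ->
     forall i, measurable_fun `[0, T] (fun s => F s (z s) i 0)) ->
  (forall i, mu.-integrable `[0, T] (fun s => (F s (x s) i 0)%:E)) ->
  (forall t, 0 <= t <= T -> forall i,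
     `|x0 i 0 + \int[mu]_(s in `[0, t]) (F s (x s) i 0) - x t i 0| <= d) ->
  exists z, solution_on T F x0 z /\
    forall t, 0 <= t <= T -> `|z t - x t| <= 2 * d * expR (l * t).
Proof.
move=> T0 wl a0 d0 cx Flip Fmeas Fint Fapp.
have TT : 0 <= T <= T by rewrite T0 lexx.
have e0 s : 0 <= expR (l * s) by exact: expR_ge0.
pose step (z : R -> 'cV[R]_n) : R -> 'cV[R]_n := fun t =>
  \col_i (x0 i 0 + \int[mu]_(s in `[0, t]) (F s (z s) i 0)).
pose Z k := iter k step x.
(* Along a curve in the tube, F is dominated by its size along [x] plus a(s) times the radius of the
   tube, which is integrable by [exp_weight]. *)
have tube_int (z : R -> 'cV[R]_n) i :
    measurable_fun `[0, T] (fun s => F s (z s) i 0) ->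
    (forall s, 0 <= s <= T -> `|z s - x s| <= 2 * d * expR (l * s)) ->
    mu.-integrable `[0, T] (fun s => (F s (z s) i 0)%:E).
  move=> mz zx.
  have [aei _] := wl.2 T TT.
  apply: (integrable_dominated (mu := mu) (f := fun s => F s (z s) i 0)
    (g := fun s => `|F s (x s) i 0| + 2 * d * (a s * expR (l * s)))) => //.
    apply: integrable_add => //; last exact: integrable_scale.
    exact: (integrable_norm (mu := mu) (f := fun s => F s (x s) i 0) (Fint i)).
  move=> s; rewrite /= in_itv/= => sT.
  have d2 : 0 <= 2 * d * expR (l * s) by rewrite !mulr_ge0.
  have : `|F s (z s) - F s (x s)| <= a s * `|z s - x s|.
    by apply: Flip => //; [exact: zx|rewrite subrr normr0].
  have := coord_le_norm (F s (z s) - F s (x s)) i; rewrite !mxE => h1 h2.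
  have h3 := ler_wpM2l (a0 s sT) (zx s sT).
  have h4 := ler_normD (F s (x s) i 0) (F s (z s) i 0 - F s (x s) i 0).
  rewrite addrC subrK in h4.
  lra.
pose q k : R := 2^-1 ^+ k.
have q0 k : 0 <= q k by rewrite exprn_ge0.
have qS k : q k.+1 = 2^-1 * q k by rewrite /q exprS.
have q1 k : q k <= 1.
  by elim: k => [|k IH]; [rewrite /q expr0|rewrite qS; have := q0 k; lra].
(* Continuity makes the next integrand measurable. The first step is at most d by [Fapp] (up to the
   weight) and the steps halve, so the k-th iterate is within 2 d (1 - 2^-k) exp(l s) of [x] and
   never leaves the tube. *)
have inv k : [/\ {within `[0, T], continuous (Z k)},
    forall s, 0 <= s <= T -> `|Z k s - x s| <= 2 * d * (1 - q k) * expR (l * s) &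
    forall s, 0 <= s <= T -> `|Z k.+1 s - Z k s| <= d * q k * expR (l * s)].
  have tube k' : (forall s, 0 <= s <= T ->
      `|Z k' s - x s| <= 2 * d * (1 - q k') * expR (l * s)) ->
      forall s, 0 <= s <= T -> `|Z k' s - x s| <= 2 * d * expR (l * s).
    move=> h s sT; apply: le_trans (h s sT) _.
    apply: ler_wpM2r => //; have := q0 k'; nra.
  elim: k => [|k [cZ hx hd]].
    split=> //.
      by move=> s sT; rewrite /Z/= subrr normr0 !mulr_ge0// subr_ge0.
    move=> t /[dup] tT /andP[t0 _]; rewrite /q expr0 mulr1.
    have e1 : 1 <= expR (l * t) by rewrite -expR0 ler_expR mulr_ge0//; case: wl.
    apply: norm_le_coord; first by rewrite mulr_ge0.
    move=> i; rewrite /Z/= !mxE; apply: le_trans (Fapp t tT i) _.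
    by rewrite ler_peMr.
  have Zi i : mu.-integrable `[0, T] (fun s => (F s (Z k s) i 0)%:E).
    by apply: tube_int; [exact: Fmeas|exact: tube].
  have cZS : {within `[0, T], continuous (Z k.+1)}.
    apply: (@integral_eq_continuous _ x0 _ (fun s => F s (Z k s)) T0 Zi).
    by move=> t tT i; rewrite /Z/= mxE.
  have hxS s : 0 <= s <= T -> `|Z k.+1 s - x s| <= 2 * d * (1 - q k.+1) * expR (l * s).
    move=> sT; have := ler_normD (Z k.+1 s - Z k s) (Z k s - x s).
    rewrite addrA subrK => /le_trans; apply.
    by have := hx s sT; have := hd s sT; rewrite qS; lra.
  have ZSi i : mu.-integrable `[0, T] (fun s => (F s (Z k.+1 s) i 0)%:E).
    by apply: tube_int; [exact: Fmeas|exact: tube].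
  split=> // t tT.
  apply: norm_le_coord; first by rewrite !mulr_ge0.
  move=> i; rewrite /Z [Z in Z - _]/= /= !mxE opprD addrACA subrr add0r.
  have := @integral_contraction F T a l (d * q k) (Z k.+1) (Z k) i t wl tT a0 (ZSi i) (Zi i).
  rewrite qS => h; apply: le_trans (h _ hd _) _.
  - by move=> s sT; apply: Flip => //; [exact: tube hxS s sT|exact: tube hx s sT].
  - by rewrite mulr_ge0.
  - by rewrite [leLHS](_ : _ = d * (2^-1 * q k) * expR (l * t))//; ring.
have lim_ex t : exists zt : 'cV[R]_n, 0 <= t <= T ->
    forall k, `|Z k t - zt| <= 2 * d * q k * expR (l * t).
  have [tT|] := boolP (0 <= t <= T); last by exists 0.
  have ex i : exists L : R, forall k, `|Z k t i 0 - L| <= 2 * (d * expR (l * t)) * q k.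
    apply: geometric_cauchy => k; rewrite mulrAC.
    have [_ _ /(_ t tT)] := inv k; apply: le_trans.
    by have := coord_le_norm (Z k.+1 t - Z k t) i; rewrite !mxE.
  have [L hL] := choice ex.
  exists (\col_i L i) => _ k; apply: norm_le_coord; first by rewrite !mulr_ge0.
  by move=> i; rewrite !mxE; apply: le_trans (hL i k) _; rewrite mulrA mulrAC.
have [z hz] := choice lim_ex.
have ztube t : 0 <= t <= T -> `|z t - x t| <= 2 * d * expR (l * t).
  by move=> tT; have := hz t tT 0%N; rewrite /q expr0 mulr1 distrC.
have Ztube k t : 0 <= t <= T -> `|Z k t - x t| <= 2 * d * expR (l * t).
  move=> tT; have [_ h _] := inv k; apply: le_trans (h t tT) _.
  by apply: ler_wpM2r => //; have := q0 k; nra.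
have FZz k s : 0 <= s <= T -> `|F s (Z k s) - F s (z s)| <= a s * `|Z k s - z s|.
  by move=> sT; apply: Flip => //; [exact: Ztube|exact: ztube].
have mZ k i : measurable_fun `[0, T] (fun s => F s (Z k s) i 0).
  by apply: Fmeas; case: (inv k).
have q_cvg : q k @[k --> \oo] --> (0 : R).
  by apply: cvg_expr; rewrite ger0_norm//; lra.
(* [Fmeas] asks for a continuous curve, which the limit [z] is not yet known to be; measurability
   comes instead from the pointwise limit of F along the iterates. *)
have mz i : measurable_fun `[0, T] (fun s => F s (z s) i 0).
  apply: (@measurable_fun_cvg _ _ _ _ (fun k s => F s (Z k s) i 0)) => //.
  move=> s; rewrite /= in_itv/= => sT.
  apply/cvgrPdist_le => e epos.
  have : a s * (2 * d * expR (l * s)) * q k @[k --> \oo] --> (0 : R).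
    rewrite -[X in _ --> X](mulr0 (a s * (2 * d * expR (l * s)))).
    by apply: cvgM => //; exact: cvg_cst.
  move=> /cvgrPdist_le /(_ e epos); apply: filterS => k.
  rewrite sub0r normrN distrC => /(le_trans (ler_norm _)); apply: le_trans.
  have := coord_le_norm (F s (Z k s) - F s (z s)) i; rewrite !mxE.
  move=> /le_trans; apply; apply: le_trans (FZz k s sT) _; rewrite -mulrA.
  by rewrite ler_wpM2l ?a0// mulrAC; exact: hz.
have zi i : mu.-integrable `[0, T] (fun s => (F s (z s) i 0)%:E) by exact: tube_int.
have Zi k i : mu.-integrable `[0, T] (fun s => (F s (Z k s) i 0)%:E).
  by apply: tube_int => //; exact: Ztube.
exists z; split=> // t tT i; split.
  apply: integrableS (zi i) => //; apply: subset_itvl; rewrite bnd_simp.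
  by case/andP: tT.
(* The residual of [z] in the equation is at most the distance from [Z k.+1] to [z] plus the change
   of the integral from [Z k] to [z]; each is at most d 2^-k exp(l t). *)
apply/eqP; rewrite -subr_eq0 -normr_le0.
apply: (@geometric_bound_le0 _ _ (2 * d * expR (l * t))) => k.
have h1 := hz t tT k.+1.
have := coord_le_norm (Z k.+1 t - z t) i; rewrite !mxE => h2.
have h3 : `|\int[mu]_(s in `[0, t]) (F s (Z k s) i 0) -
    \int[mu]_(s in `[0, t]) (F s (z s) i 0)| <= 2 * d * q k * (2^-1 * expR (l * t)).
  apply: (integral_contraction wl tT a0 (Zi k i) (zi i)).
  - by move=> s sT; exact: FZz.
  - by move=> s sT; exact: hz.
  - by rewrite !mulr_ge0.
rewrite -/(q k).
move: h1 h2 h3; rewrite qS.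
set I1 := \int[mu]_(s in _) _; set I2 := \int[mu]_(s in _) _.
move=> h1 h2 h3.
have -> : z t i 0 - (x0 i 0 + I2) = (I1 - I2) - (x0 i 0 + I1 - z t i 0) by ring.
apply: le_trans (ler_normB _ _) _; lra.
Qed.

End IntegralEquations.

(** * Smooth fields are bounded and Lipschitz on balls *)

Section SmoothFields.
Variables (R : realType) (n : nat).
Implicit Types (f : 'cV[R]_n -> 'cV[R]_n) (x y v : 'cV[R]_n).

(** For the sup norm the ball is a cube: the image under transposition of a product of segments. *)
Lemma closed_ball_compact (rho : R) : compact [set x : 'cV[R]_n | `|x| <= rho].
Proof.
pose B : set 'rV[R]_n := [set v | forall i, `[- rho, rho]%classic (v ord0 i)].
have cB : compact B.
  by apply: (@rV_compact R n (fun=> `[- rho, rho]%classic)) => i; exact: segment_compact.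
have ct : continuous (fun v : 'rV[R]_n => v^T).
  apply: continuous_coords => i.
  rewrite (_ : (fun t : 'rV[R]_n => t^T i 0) = fun t : 'rV[R]_n => t 0 i).
    exact: coord_continuous.
  by apply/funext => v; rewrite mxE.
have [rho0|rho0] := leP 0 rho; last first.
  rewrite (_ : [set x | _] = set0); first exact: compact0.
  apply/seteqP; split => x //= xr.
  by have := le_lt_trans (le_trans (normr_ge0 x) xr) rho0; rewrite ltxx.
rewrite (_ : [set x | _] = (fun v : 'rV[R]_n => v^T) @` B).
  by apply: continuous_compact => //; exact: continuous_subspaceT.
apply/seteqP; split => [x /= xr|_ [v Bv <-]] /=.
  exists x^T; last by rewrite trmxK.
  move=> i; rewrite /= in_itv/= mxE -ler_norml; apply: le_trans xr.
  exact: coord_le_norm.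
apply: norm_le_coord => // i; rewrite mxE ler_norml.
by have := Bv i; rewrite /= in_itv.
Qed.

Lemma continuous_bounded_on_ball (m : nat) (h : 'cV[R]_n -> 'cV[R]_m) (rho : R) : continuous h ->
  exists M : R, 0 <= M /\ forall x, `|x| <= rho -> `|h x| <= M.
Proof.
move=> ch.
have : compact ((fun x => `|h x|) @` [set x : 'cV[R]_n | `|x| <= rho]).
  apply: continuous_compact; last exact: closed_ball_compact.
  apply: continuous_subspaceT => x.
  by apply: continuous_comp; [exact: ch|exact: norm_continuous].
move=> /compact_bounded[M [Mr hM]].
have M1 : M < Num.max M 0 + 1 by rewrite ltr_pwDr// le_max lexx.
exists (Num.max M 0 + 1); split; first by rewrite addr_ge0// le_max lexx orbT.
move=> x xr; have := hM _ M1 `|h x|; rewrite /= normr_id; apply.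
by exists x.
Qed.

(** Reduces a vector field to a real function of one variable, to which the mean value theorem
    applies; the two difference quotients coincide. *)
Lemma is_derive_along_line f y v i t : differentiable f (y + t *: v) ->
  is_derive t 1 (fun s : R => f (y + s *: v) i 0) (('D_v f (y + t *: v)) i 0).
Proof.
move=> df.
have dv : derivable f (y + t *: v) v by exact: diff_derivable.
pose phi s : R := f (y + s *: v) i 0.
have E : (fun h : R => h^-1 *: ((phi \o shift t) (h *: 1) - phi t))
  = (fun h : R => (h^-1 *: ((f \o shift (y + t *: v)) (h *: v) - f (y + t *: v))) i 0).
  apply/funext => h.
  have L : y + (h *: (1 : R) + t) *: v = h *: v + (y + t *: v).
    by rewrite -[h *: 1]/(h * 1) mulr1 scalerDl addrCA.
  transitivity (h^-1 * (f (h *: v + (y + t *: v)) i 0 - f (y + t *: v) i 0)).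
    by congr (_ * (f _ i 0 - _)); exact: L.
  by rewrite !mxE.
have cv : (fun h : R => h^-1 *: ((phi \o shift t) (h *: 1) - phi t)) @ 0^' -->
    (('D_v f (y + t *: v)) i 0 : R).
  rewrite E.
  apply: (@cvg_comp _ _ _
    (fun h : R => h^-1 *: ((f \o shift (y + t *: v)) (h *: v) - f (y + t *: v)))
    (fun M : 'cV[R]_n => M i 0) _ (nbhs ('D_v f (y + t *: v)))).
    exact: dv.
  exact: coord_continuous.
by split; [apply/cvg_ex; eexists; exact: cv|exact: cvg_lim].
Qed.

(** Mean value theorem on the segment from y to x, one coordinate at a time. By convexity the
    segment stays in the ball, where compactness bounds the partial derivatives by [M j]. *)
Lemma C1_lipschitz_on_ball f (rho : R) : Ck_field 1 f ->
  exists L : R, 0 <= L /\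
    forall x y, `|x| <= rho -> `|y| <= rho -> `|f x - f y| <= L * `|x - y|.
Proof.
move=> [df cDf].
have bD (j : 'I_n) : exists M : R, 0 <= M /\
    forall x, `|x| <= rho -> `|'D_(delta_mx j 0) f x| <= M.
  by apply: continuous_bounded_on_ball; exact: cDf.
have [M hM] := choice bD.
exists (\sum_j M j); split; first by apply: sumr_ge0 => j _; case: (hM j).
move=> x y xr yr; apply: norm_le_coord.
  by rewrite mulr_ge0// sumr_ge0// => j _; case: (hM j).
move=> i; rewrite !mxE.
pose v := x - y.
have dphi (t : R) : is_derive t 1 (fun s : R => f (y + s *: v) i 0)
    (('D_v f (y + t *: v)) i 0).
  exact: is_derive_along_line.
have cphi : {within `[0, 1], continuous (fun s : R => f (y + s *: v) i 0)}.
  apply: continuous_subspaceT => t.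
  by apply/differentiable_continuous/derivable1_diffP; case: (dphi t).
have [c] := MVT_segment ler01 (fun t _ => dphi t) cphi.
rewrite in_itv/= => /andP[c0 c1].
rewrite scale1r scale0r addr0 subr0 mulr1 /v [y + _]addrC subrK -/v => ->.
set p := y + c *: v.
have pr : `|p| <= rho.
  have -> : p = (1 - c) *: y + c *: x.
    by rewrite /p /v scalerBr scalerBl scale1r addrCA addrC.
  apply: le_trans (ler_normD _ _) _; rewrite !normrZ !ger0_norm ?subr_ge0//.
  have := ler_wpM2l c0 xr; have c1' : 0 <= 1 - c by lra.
  have := ler_wpM2l c1' yr; lra.
(* The direction v varies with x and y, while bounds are at hand for fixed directions only;
   linearity of the differential reduces to the coordinate ones. *)
have -> : 'D_v f p = \sum_j v j 0 *: 'D_(delta_mx j 0) f p.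
  rewrite deriveE// [in LHS](matrix_sum_delta v) linear_sum; apply: eq_bigr => j _.
  by rewrite big_ord1 linearZ deriveE.
rewrite summxE mulr_suml; apply: le_trans (ler_norm_sum _ _ _) _.
apply: ler_sum => j _; rewrite mxE normrM mulrC.
apply: ler_pM => //; last exact: coord_le_norm.
by apply: le_trans (coord_le_norm _ _) _; case: (hM j) => _; apply.
Qed.

End SmoothFields.

(** * The controlled dynamics: Lipschitz bounds, uniqueness, truncation *)

Section ControlSystem.
Variables (R : realType) (n k : nat).
Variables (f : 'cV[R]_n -> 'cV[R]_n) (g : 'I_k -> 'cV[R]_n -> 'cV[R]_n).
Hypotheses (f_smooth : smooth_field f) (g_smooth : forall j, smooth_field (g j)).
Notation mu := (@lebesgue_measure R).
Implicit Types (u w : R -> 'cV[R]_k) (x y z : R -> 'cV[R]_n) (T : R).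

Definition dynamics u : R -> 'cV[R]_n -> 'cV[R]_n :=
  fun t p => f p + control_mx g p *m u t.

Lemma dynamicsE u t p i :
  dynamics u t p i 0 = f p i 0 + \sum_j g j p i 0 * u t j 0.
Proof.
by rewrite /dynamics !mxE; congr (_ + _); apply: eq_bigr => j _; rewrite mxE.
Qed.

Lemma fields_lipschitz_on_ball (rho : R) : exists L : R, 0 <= L /\
  forall p q : 'cV[R]_n, `|p| <= rho -> `|q| <= rho ->
    `|f p - f q| <= L * `|p - q| /\ forall j, `|g j p - g j q| <= L * `|p - q|.
Proof.
have [Lf [Lf0 hLf]] := C1_lipschitz_on_ball rho (f_smooth 1).
have [Lg hLg] := choice (fun j => C1_lipschitz_on_ball rho (g_smooth j 1)).
have Lg0 : 0 <= \sum_j Lg j by apply: sumr_ge0 => j _; case: (hLg j).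
exists (Lf + \sum_j Lg j); split; first exact: addr_ge0.
move=> p q pr qr; split=> [|j].
  by apply: le_trans (hLf p q pr qr) _; rewrite ler_wpM2r// lerDl.
have [_ h] := hLg j; apply: le_trans (h p q pr qr) _; rewrite ler_wpM2r//.
rewrite (bigD1 j)//= addrCA lerDl addr_ge0// sumr_ge0// => j' _.
by case: (hLg j').
Qed.

(** The Lipschitz constant in the state depends on time through |u(t)|; it serves as the function
    [a] of [exp_weight]. *)
Lemma dynamics_lipschitz u (L : R) t (p q : 'cV[R]_n) : 0 <= L ->
  `|f p - f q| <= L * `|p - q| -> (forall j, `|g j p - g j q| <= L * `|p - q|) ->
  `|dynamics u t p - dynamics u t q| <= L * (1 + \sum_j `|u t j 0|) * `|p - q|.
Proof.
move=> L0 fpq gpq; apply: norm_le_coord.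
  by rewrite !mulr_ge0 ?addr_ge0 ?sumr_ge0.
move=> i; rewrite [X in `|X|]mxE [X in _ + X]mxE !dynamicsE opprD addrACA -sumrB.
apply: le_trans (ler_normD _ _) _.
rewrite mulrAC mulrDr mulr1; apply: lerD.
  by have := coord_le_norm (f p - f q) i; rewrite !mxE => /le_trans; apply.
rewrite mulr_sumr; apply: le_trans (ler_norm_sum _ _ _) _; apply: ler_sum => j _.
rewrite -mulrBl normrM ler_wpM2r//.
by have := coord_le_norm (g j p - g j q) i; rewrite !mxE => /le_trans; apply.
Qed.

Lemma field_coord_continuous (h : 'cV[R]_n -> 'cV[R]_n) i :
  smooth_field h -> continuous (fun p => h p i 0).
Proof. by move=> hs; apply: continuous_coord; exact: (hs 0%N). Qed.

Lemma measurable_dynamics u z T i :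
  (forall j, measurable_fun `[0, T] (fun s => u s j 0)) ->
  {within `[0, T], continuous z} ->
  measurable_fun `[0, T] (fun s => dynamics u s (z s) i 0).
Proof.
move=> um cz.
rewrite (_ : (fun s => _) = (fun s => f (z s) i 0 + \sum_j g j (z s) i 0 * u s j 0)); last first.
  by apply/funext => s; rewrite dynamicsE.
apply: measurable_funD.
  apply: (@measurable_continuous_comp _ _ _ z (fun p => f p i 0)) => //.
  exact: field_coord_continuous.
apply: measurable_sum => j; apply: measurable_funM => //.
apply: (@measurable_continuous_comp _ _ _ z (fun p => g j p i 0)) => //.
exact: field_coord_continuous.
Qed.

Lemma weight_integrable u T (L : R) :
  (forall j, mu.-integrable `[0, T] (fun s => (u s j 0)%:E)) ->
  mu.-integrable `[0, T] (EFin \o (fun s => L * (1 + \sum_j `|u s j 0|))).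
Proof.
move=> ui; apply: integrable_scale => //; apply: integrable_add => //.
  exact: integrable_cst_itv.
apply: integrable_bigsum => // j.
exact: (integrable_norm (mu := mu) (f := fun s => u s j 0) (ui j)).
Qed.

(** Both solutions are bounded on [0, T], so one ball contains them and the Lipschitz constant of
    the fields on that ball is enough. *)
Lemma control_solution_unique u T (x0 : 'cV[R]_n) x y : 0 <= T ->
  (forall j, mu.-integrable `[0, T] (fun s => (u s j 0)%:E)) ->
  solution_on T (dynamics u) x0 x -> solution_on T (dynamics u) x0 y ->
  forall t, 0 <= t <= T -> x t = y t.
Proof.
move=> T0 ui xs ys.
have [Mx [Mx0 hMx]] := within_continuous_bounded (solution_on_continuous T0 xs).
have [My [My0 hMy]] := within_continuous_bounded (solution_on_continuous T0 ys).
have [L [L0 hL]] := fields_lipschitz_on_ball (Mx + My).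
apply: (solution_on_unique T0 (weight_integrable L ui) _ xs ys).
  by move=> s _; rewrite mulr_ge0 ?addr_ge0 ?sumr_ge0.
move=> s sT.
have xr : `|x s| <= Mx + My by have := hMx s sT; lra.
have yr : `|y s| <= Mx + My by have := hMy s sT; lra.
by have [h1 h2] := hL _ _ xr yr; exact: dynamics_lipschitz.
Qed.

Definition clamp (N r : R) : R := Num.max (- N) (Num.min r N).

(** The three bounds serve in turn to put the truncated control in [Lp] on [0, T], to reuse the
    Lipschitz weight of [u], and to compare the two dynamics in mean. *)
Lemma clamp_spec (N r : R) : 0 <= N ->
  [/\ `|clamp N r| <= N, `|clamp N r| <= `|r| &
      `|clamp N r - r| <= Num.max (`|r| - N) 0].
Proof.
move=> N0; have E := (maxEle, minEle, ler_norml, le_max).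
rewrite /clamp; case: (leP r N) => rN; case: (leP (- N)) => Nr; split;
  case: (ger0P r) => r0; rewrite ?le_max ?ler_norml; lra.
Qed.

Lemma bounded_control_approx u (x0 : 'cV[R]_n) x T (e : R) : 0 <= T -> 0 < e ->
  (forall j, mu.-integrable `[0, T] (fun s => (u s j 0)%:E)) ->
  solution_on T (dynamics u) x0 x ->
  exists (w : R -> 'cV[R]_k) (N : R) (z : R -> 'cV[R]_n),
    [/\ forall j, measurable_fun `[0, T] (fun s => w s j 0),
        forall s j, `|w s j 0| <= N,
        solution_on T (dynamics w) x0 z &
        forall t, 0 <= t <= T -> `|z t - x t| <= e].
Proof.
move=> T0 e0 ui xs.
have TT : 0 <= T <= T by rewrite T0 lexx.
have cx := solution_on_continuous T0 xs.
have [rho [rho0 hx]] := within_continuous_bounded cx.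
(* The tube will have radius at most [e1] <= 1, so it lies in the ball of radius rho + 1. *)
have [L [L0 hL]] := fields_lipschitz_on_ball (rho + 1).
have [Mf [Mf0 hMf]] := continuous_bounded_on_ball rho (f_smooth 0).
have [Mg_ hMg_] := choice (fun j => continuous_bounded_on_ball rho (g_smooth j 0)).
pose Mg := 1 + \sum_j Mg_ j.
have Mg0 : 0 < Mg.
  by rewrite ltr_pwDl// sumr_ge0// => j _; case: (hMg_ j).
have hMg j (p : 'cV[R]_n) : `|p| <= rho -> `|g j p| <= Mg.
  move=> pr; have [_ h] := hMg_ j; apply: le_trans (h p pr) _.
  rewrite /Mg (bigD1 j)//= addrCA lerDl addr_ge0// sumr_ge0// => j' _.
  by case: (hMg_ j').
pose a (s : R) : R := L * (1 + \sum_j `|u s j 0|).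
have ai : mu.-integrable `[0, T] (EFin \o a) by exact: weight_integrable.
have a0 s : 0 <= s <= T -> 0 <= a s.
  by move=> _; rewrite /a mulr_ge0 ?addr_ge0 ?sumr_ge0.
have [l wl] := expR_weight T0 ai a0.
pose e1 := Num.min 1 e.
have e10 : 0 < e1 by rewrite /e1 lt_min ltr01.
(* The tube radius 2 d exp(l t) is largest at T, where this choice makes it [e1]. *)
pose d := e1 / (2 * expR (l * T)).
have d0 : 0 < d by rewrite divr_gt0// mulr_gt0// expR_gt0.
have dE t : 0 <= t <= T -> 2 * d * expR (l * t) <= e1.
  move=> /andP[t0 tT]; rewrite /d.
  have et : expR (l * t) <= expR (l * T).
    by rewrite ler_expR ler_wpM2l//; case: wl.
  have eT := expR_gt0 (l * T).
  rewrite (_ : 2 * _ * _ = e1 * (expR (l * t) / expR (l * T))); last first.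
    by field; rewrite gt_eqF.
  by rewrite ger_pMr// ler_pdivrMr// mul1r.
have k0 : (0 : R) < k%:R + 1 by rewrite ltr_pwDr.
(* Each of the k inputs contributes at most Mg d' to the defect of [x], so the total is at most d;
   the added 1 covers k = 0. *)
pose d' := d / (Mg * (k%:R + 1)).
have d'0 : 0 < d' by rewrite divr_gt0// mulr_gt0.
have exN (j : 'I_k) : exists N : nat,
    \int[mu]_(s in `[0, T]) Num.max (`|u s j 0| - N%:R) 0 <= d'.
  exact: (truncation_small (mu := mu) (f := fun s => u s j 0) _ (ui j) d'0).
have [N hN] := choice exN.
pose w s : 'cV[R]_k := \col_j clamp (N j)%:R (u s j 0).
have um j : measurable_fun `[0, T] (fun s => u s j 0).
  by apply/measurable_EFinP; exact: measurable_int (ui j).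
have mw j : measurable_fun `[0, T] (fun s => w s j 0).
  rewrite (_ : (fun s => _) = fun s => Num.max (- (N j)%:R) (Num.min (u s j 0) (N j)%:R)).
    by apply: measurable_maxr => //; exact: measurable_minr.
  by apply/funext => s; rewrite mxE.
have hw s j := clamp_spec (u s j 0) (ler0n R (N j)).
have wu s j : `|w s j 0| <= `|u s j 0| by rewrite mxE; case: (hw s j).
pose r (j : 'I_k) s := Num.max (`|u s j 0| - (N j)%:R) 0.
have mr j : measurable_fun `[0, T] (r j).
  apply: measurable_maxr => //; apply: measurable_funB => //.
  exact: measurableT_comp.
have uni j : mu.-integrable `[0, T] (EFin \o (fun s => `|u s j 0|)).
  exact: (integrable_norm (mu := mu) (f := fun s => u s j 0) (ui j)).
have ri j : mu.-integrable `[0, T] (EFin \o r j).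
  apply: (integrable_dominated (mu := mu) (g := fun s => `|u s j 0|)) => //.
    exact: mr.
  move=> s _; rewrite /r ger0_norm; last by rewrite le_max lexx orbT.
  by rewrite ge_max normr_ge0 andbT gerBl.
have Fwi i : mu.-integrable `[0, T] (EFin \o (fun s => dynamics w s (x s) i 0)).
  apply: (integrable_dominated (mu := mu) (g := fun s => Mf + \sum_j Mg * `|u s j 0|)) => //.
  - exact: measurable_dynamics.
  - apply: integrable_add => //; first exact: integrable_cst_itv.
    by apply: integrable_bigsum => // j; exact: integrable_scale.
  move=> s; rewrite /= in_itv/= => sT.
  rewrite dynamicsE; apply: le_trans (ler_normD _ _) _; apply: lerD.
    by apply: le_trans (coord_le_norm _ _) _; apply: hMf; exact: hx.
  apply: le_trans (ler_norm_sum _ _ _) _; apply: ler_sum => j _.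
  rewrite normrM; apply: ler_pM => //.
  by apply: le_trans (coord_le_norm _ _) _; apply: hMg; exact: hx.
have [z [zs zx]] : exists z, solution_on T (dynamics w) x0 z /\
    forall t, 0 <= t <= T -> `|z t - x t| <= 2 * d * expR (l * t).
  apply: (picard_perturbation T0 wl a0 (ltW d0) cx) => //.
  - move=> s sT p q ps qs.
    have e1le : e1 <= 1 by rewrite /e1 ge_min lexx.
    have ball (p' : 'cV[R]_n) : `|p' - x s| <= 2 * d * expR (l * s) -> `|p'| <= rho + 1.
      move=> ps'; rewrite -[p'](subrK (x s)); apply: le_trans (ler_normD _ _) _.
      by have := dE s sT; have := hx s sT; lra.
    have [h1 h2] := hL p q (ball p ps) (ball q qs).
    apply: le_trans (dynamics_lipschitz w s L0 h1 h2) _.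
    rewrite ler_wpM2r// ler_wpM2l// lerD2l; apply: ler_sum => j _; exact: wu.
  - by move=> z cz i; exact: measurable_dynamics.
  move=> t /[dup] tT /andP[t0 tleT] i.
  have sub : `[0, t] `<=` `[0, T] by apply: subset_itvl; rewrite bnd_simp.
  have [Fui ->] := xs t tT i.
  have Fwit : mu.-integrable `[0, t] (EFin \o (fun s => dynamics w s (x s) i 0)).
    exact: integrableS (Fwi i).
  rewrite opprD addrACA subrr add0r -RintegralB//.
  (* The defect of [x] in the equation of [w] comes only from the terms g_j (w_j - u_j), with |g_j|
     <= Mg along [x]. *)
  apply: (@le_trans _ _ (\int[mu]_(s in `[0, t]) \sum_j Mg * r j s)).
    apply: norm_Rintegral_le => //.
    - exact: integrable_sub.
    - apply: integrable_bigsum => // j; apply: integrable_scale => //.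
      exact: integrableS (ri j).
    move=> s; rewrite /= in_itv/= => /andP[s0 st].
    have sT : 0 <= s <= T by rewrite s0 (le_trans st).
    rewrite !dynamicsE opprD addrACA subrr add0r -sumrB.
    apply: le_trans (ler_norm_sum _ _ _) _; apply: ler_sum => j _.
    rewrite -mulrBr normrM; apply: ler_pM => //.
      by apply: le_trans (coord_le_norm _ _) _; apply: hMg; exact: hx.
    by rewrite mxE; case: (hw s j).
  have rti j : mu.-integrable `[0, t] (EFin \o r j) by exact: integrableS (ri j).
  rewrite Rintegral_sum//; last by move=> j; exact: integrable_scale.
  apply: (@le_trans _ _ (\sum_(j < k) Mg * d')).
    apply: ler_sum => j _; rewrite RintegralZl//.
    apply: ler_wpM2l; first exact: ltW.
    apply: le_trans (hN j); apply: Rintegral_subset => //.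
    by move=> s _; rewrite /r le_max lexx orbT.
  rewrite sumr_const card_ord -mulr_natl.
  rewrite (_ : k%:R * (Mg * d') = d * (k%:R / (k%:R + 1))); last first.
    by rewrite /d'; field; rewrite !gt_eqF.
  by rewrite ger_pMr// ler_pdivrMr// mul1r lerDl.
exists w, (\sum_j (N j)%:R), z; split=> //.
  move=> s j; rewrite mxE; case: (hw s j) => h _ _; apply: le_trans h _.
  by rewrite (bigD1 j)//= lerDl sumr_ge0.
move=> t tT; apply: le_trans (zx t tT) _; apply: le_trans (dE t tT) _.
by rewrite /e1 ge_min lexx orbT.
Qed.

End ControlSystem.

(** * Concatenation of trajectories *)

Section Concatenation.
Variables (R : realType) (n : nat).
Notation mu := (@lebesgue_measure R).

(** A sum of two extensions by zero; the half-open second interval keeps them from overlapping at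
    b. *)
Lemma integrable_glue (a b c : R) (h : R -> R) : a <= b -> b <= c ->
  mu.-integrable `[a, b] (EFin \o h) -> mu.-integrable `]b, c] (EFin \o h) ->
  mu.-integrable `[a, c] (EFin \o h).
Proof.
move=> ab bc hab hbc.
pose k s : R := (h \_ `[a, b]) s + (h \_ `]b, c]) s.
have iT (D : set (measurableTypeR R)) : measurable D ->
    mu.-integrable D (EFin \o h) -> mu.-integrable setT (EFin \o (h \_ D)).
  by move=> mD hD; rewrite -restrict_EFin; apply/integrable_restrict => //; rewrite setTI.
have ki : mu.-integrable setT (EFin \o k).
  apply: integrable_add => //; first exact: iT.
  exact: iT.
have : mu.-integrable `[a, c] (EFin \o k) by exact: integrableS ki.
apply: eq_integrable => // s; rewrite inE/= in_itv/= => /andP[as_ sc].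
congr EFin; rewrite /k !patchE.
have [sb|bs] := leP s b.
  rewrite mem_set/= ?in_itv/= ?as_// memNset/= ?addr0//.
  by rewrite in_itv/= ltNge sb.
rewrite memNset/= ?in_itv/= ?as_/=; last by rewrite leNgt bs.
by rewrite mem_set/= ?add0r// in_itv/= bs sc.
Qed.

(** The second field is autonomous, so translating time by T turns its integral over [0, t - T] into
    one over [T, t], to be added to the integral up to T. *)
Lemma solution_concat (T : R) (F G : R -> 'cV[R]_n -> 'cV[R]_n)
    (H : 'cV[R]_n -> 'cV[R]_n) (x0 : 'cV[R]_n) (z y : R -> 'cV[R]_n) :
  0 <= T -> (forall s p, s <= T -> G s p = F s p) ->
  (forall s p, T < s -> G s p = H p) ->
  solution_on T F x0 z -> is_solution (fun=> H) (z T) y ->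
  is_solution G x0 (fun t => if t <= T then z t else y (t - T)).
Proof.
move=> T0 GF GH zs ys.
set X := fun t => _.
have TT : 0 <= T <= T by rewrite T0 lexx.
have onT t i : 0 <= t <= T -> mu.-integrable `[0, t] (fun s => (G s (X s) i 0)%:E) /\
    \int[mu]_(s in `[0, t]) G s (X s) i 0 = \int[mu]_(s in `[0, t]) F s (z s) i 0.
  move=> tT; have [Fi _] := zs t tT i.
  have E s : s \in `[0, t]%classic -> G s (X s) i 0 = F s (z s) i 0.
    rewrite inE/= in_itv/= => /andP[s0 st]; rewrite /X.
    by have sT : s <= T; [case/andP: tT => _; exact: le_trans|rewrite sT GF].
  split; last exact: eq_Rintegral.
  by apply: eq_integrable Fi => // s /E ->.
move=> t t0 i; have [tT|Tt] := leP t T.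
  have tT' : 0 <= t <= T by rewrite t0.
  have [Gi ->] := onT t i tT'; split=> //.
  by rewrite /X tT; have [_ ->] := zs t tT' i.
have [GiT GET] := onT T i TT.
have tT0 : 0 <= t - T by rewrite subr_ge0 ltW.
have [Hi yE] := ys (t - T) tT0 i.
have [Hsi HsE] := integral_shift T (h := fun s => H (y s) i 0) Hi.
rewrite add0r subrK in Hsi HsE.
have EH s : s \in `]T, t]%classic -> H (y (s - T)) i 0 = G s (X s) i 0.
  rewrite inE/= in_itv/= => /andP[Ts st].
  by rewrite /X leNgt Ts/= GH.
have mi : mu.-integrable `]T, t] (fun s => (G s (X s) i 0)%:E).
  have : mu.-integrable `]T, t] (EFin \o (fun s => H (y (s - T)) i 0)).
    apply: integrableS Hsi => //.
    by move=> s /=; rewrite !in_itv/= => /andP[/ltW -> ->].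
  by apply: eq_integrable => // s /EH /= ->.
have Gi : mu.-integrable `[0, t] (EFin \o (fun s => G s (X s) i 0)).
  by apply: (@integrable_glue 0 T t) => //; exact: ltW.
split=> //.
rewrite /X leNgt Tt/= yE.
have [_ ->] := zs T TT i.
rewrite -addrA; congr (_ + _).
have := Rintegral_itvB (x := T) Gi; rewrite !bnd_simp => /(_ T0 (ltW Tt)).
rewrite GET => /eqP; rewrite subr_eq => /eqP ->; rewrite addrC; congr (_ + _).
rewrite -HsE -Rintegral_itv_obnd_cbnd.
  exact: eq_Rintegral.
apply: integrableS Hsi => //.
by move=> s /=; rewrite !in_itv/= => /andP[/ltW -> ->].
Qed.

End Concatenation.

Lemma continuous_bigsum (R : realType) (S : topologicalType) (I : finType) (h : I -> S -> R) :
  (forall i, continuous (h i)) -> continuous (fun s => \sum_i h i s).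
Proof.
move=> ch; rewrite (_ : (fun s => _) = \sum_i h i); last first.
  by apply/funext => s; rewrite fct_sumE.
apply: (big_ind (fun k : S -> R => continuous k)) => //.
- by move=> s; exact: cvg_cst.
- by move=> k1 k2 c1 c2 s; apply: cvgD; [exact: c1|exact: c2].
Qed.

Lemma continuous_scaled_mul (R : realType) (S : topologicalType) (c : R) (h1 h2 : S -> R) :
  continuous h1 -> continuous h2 -> continuous (fun s => c * h1 s * h2 s).
Proof.
move=> ch1 ch2 s; apply: cvgM; last exact: ch2.
by apply: cvgM; [exact: cvg_cst|exact: ch1].
Qed.

(** * The quadratic form against the squared sup norm *)

Section QuadraticForm.
Variables (R : realType) (n : nat) (P : 'M[R]_n).
Hypothesis P_posdef : sym_posdef P.
Implicit Types x y z : 'cV[R]_n.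

Lemma quad_formE x : quad_form P x = \sum_i \sum_j x j 0 * P j i * x i 0.
Proof.
rewrite /quad_form mxE; apply: eq_bigr => i _.
by rewrite mxE mulr_suml; apply: eq_bigr => j _; rewrite mxE.
Qed.

Lemma quad_form_ge0 x : 0 <= quad_form P x.
Proof.
have [->|x0] := eqVneq x 0; last by apply: ltW; apply: P_posdef.2.
by rewrite /quad_form mulmx0 mxE.
Qed.

Lemma posdef_unitmx : P \in unitmx.
Proof.
rewrite -row_free_unit -kermx_eq0; apply/rowV0P => v /sub_kermxP vP.
apply/eqP; apply: contraT => v0.
have := P_posdef.2 v^T; rewrite /quad_form trmxK vP mul0mx mxE ltxx.
by apply; apply: contra v0 => /eqP/(congr1 trmx); rewrite trmxK trmx0 => ->.
Qed.

(* Cauchy-Schwarz for the form P, applied to x and P^-1 e_i: their P-product is x_i. *)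
Lemma coord_le_quad_form i : exists c : R, 0 <= c /\
  forall x, x i 0 ^+ 2 <= c * quad_form P x.
Proof.
have [Psym Ppos] := P_posdef.
have [z Pz] : exists z : 'cV[R]_n, P *m z = delta_mx i 0.
  by exists (invmx P *m delta_mx i 0); rewrite mulKVmx// posdef_unitmx.
have zP : z^T *m P = (delta_mx i 0 : 'cV[R]_n)^T by rewrite -Pz trmx_mul Psym.
have z0 : z != 0.
  apply/eqP => z0; have := congr1 (fun M : 'cV[R]_n => M i 0) Pz.
  by rewrite z0 mulmx0 !mxE !eqxx => /esym/eqP; rewrite oner_eq0.
pose c := quad_form P z.
have c0 : 0 < c by exact: Ppos.
exists c; split; first exact: ltW.
move=> x.
have zPx : (z^T *m P *m x) 0 0 = x i 0.
  rewrite zP trmx_delta mxE (bigD1 i)//= big1 ?addr0 ?mxE ?eqxx ?mul1r//.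
  by move=> j ji; rewrite mxE eqxx (negbTE ji) mul0r.
have xPz : (x^T *m P *m z) 0 0 = x i 0.
  rewrite -mulmxA Pz mxE (bigD1 i)//= big1 ?addr0 ?mxE ?eqxx ?mulr1//.
  by move=> j ji; rewrite !mxE (negbTE ji) mulr0.
(* With c the value of the form at z and both cross terms equal to x_i, this nonnegative value
   expands to c times the wanted difference. *)
have := quad_form_ge0 (c *: x - x i 0 *: z).
have -> : quad_form P (c *: x - x i 0 *: z) = c * (c * quad_form P x - x i 0 ^+ 2).
  have tr : (c *: x - x i 0 *: z)^T = c *: x^T - x i 0 *: z^T.
    by apply/matrixP => r s; rewrite !mxE.
  have e1 (r : R) (A : 'M[R]_1) : (r *: A) 0 0 = r * A 0 0 by rewrite mxE.
  have e2 (A B : 'M[R]_1) : (A - B) 0 0 = A 0 0 - B 0 0 by rewrite !mxE.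
  rewrite {1}/quad_form tr !mulmxBl !mulmxBr -!scalemxAl -!scalemxAr !e2 !e1.
  move: zPx xPz; rewrite /c /quad_form.
  set a := (x^T *m P *m x) 0 0; set b := (x^T *m P *m z) 0 0.
  set b' := (z^T *m P *m x) 0 0; set d := (z^T *m P *m z) 0 0.
  by move=> -> ->; ring.
by rewrite pmulr_rge0// subr_ge0.
Qed.

(** This is what makes a small running cost force a small state. The added 1 keeps the constant
    positive, so that it can be divided by. *)
Lemma norm_le_quad_form : exists c : R, 0 < c /\
  forall x, `|x| ^+ 2 <= c * quad_form P x.
Proof.
have [c hc] := choice coord_le_quad_form.
have C0 : 0 < 1 + \sum_i c i.
  by rewrite ltr_pwDl// sumr_ge0// => i _; case: (hc i).
exists (1 + \sum_i c i); split=> // x.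
have q0 := quad_form_ge0 x.
have B0 : 0 <= (1 + \sum_i c i) * quad_form P x by rewrite mulr_ge0// ltW.
rewrite -(sqr_sqrtr B0) ler_sqr ?nnegrE ?sqrtr_ge0//.
apply: norm_le_coord; first exact: sqrtr_ge0.
move=> i; rewrite -ler_sqr ?nnegrE ?sqrtr_ge0//.
rewrite (sqr_sqrtr B0) real_normK ?num_real//.
have [_ h] := hc i; apply: le_trans (h x) _; rewrite ler_wpM2r//.
rewrite (bigD1 i)//= addrCA lerDl addr_ge0// sumr_ge0// => j _.
by case: (hc j).
Qed.

Definition abs_sum : R := \sum_i \sum_j `|P j i|.

Lemma abs_sum_ge0 : 0 <= abs_sum.
Proof. by apply: sumr_ge0 => i _; apply: sumr_ge0. Qed.

Lemma quad_form_le x : quad_form P x <= abs_sum * `|x| ^+ 2.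
Proof.
rewrite quad_formE /abs_sum mulr_suml; apply: ler_sum => i _.
rewrite mulr_suml; apply: ler_sum => j _.
apply: le_trans (ler_norm _) _; rewrite !normrM mulrAC mulrC.
by rewrite ler_wpM2l// expr2 ler_pM//; exact: coord_le_norm.
Qed.

(** The difference of products splits as x_j (x_i - y_i) + (x_j - y_j) y_i, each part being at most
    r |x - y|. *)
Lemma quad_form_lipschitz (r : R) x y : `|x| <= r -> `|y| <= r ->
  quad_form P x <= quad_form P y + abs_sum * (2 * r * `|x - y|).
Proof.
move=> xr yr; rewrite -lerBlDl !quad_formE -sumrB /abs_sum mulr_suml.
apply: ler_sum => i _; rewrite -sumrB mulr_suml; apply: ler_sum => j _.
have -> : x j 0 * P j i * x i 0 - y j 0 * P j i * y i 0 =
    P j i * (x j 0 * (x i 0 - y i 0) + (x j 0 - y j 0) * y i 0) by ring.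
apply: le_trans (ler_norm _) _; rewrite normrM ler_wpM2l//.
apply: le_trans (ler_normD _ _) _; rewrite !normrM.
have hi : `|x i 0 - y i 0| <= `|x - y|.
  by have := coord_le_norm (x - y) i; rewrite !mxE.
have hj : `|x j 0 - y j 0| <= `|x - y|.
  by have := coord_le_norm (x - y) j; rewrite !mxE.
have xj := le_trans (coord_le_norm x j) xr.
have yi := le_trans (coord_le_norm y i) yr.
have h1 : `|x j 0| * `|x i 0 - y i 0| <= r * `|x - y| by exact: ler_pM.
have h2 : `|x j 0 - y j 0| * `|y i 0| <= `|x - y| * r by exact: ler_pM.
lra.
Qed.

Lemma quad_form_continuous : continuous (quad_form P).
Proof.
move=> x.
rewrite (_ : quad_form P = fun y => \sum_i \sum_j P j i * y j 0 * y i 0); last first.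
  apply/funext => y; rewrite quad_formE.
  by apply: eq_bigr => i _; apply: eq_bigr => j _; rewrite [P j i * _]mulrC.
move: x; apply: continuous_bigsum => i; apply: continuous_bigsum => j.
by apply: continuous_scaled_mul; exact: coord_continuous.
Qed.

End QuadraticForm.

(** * Comparison of the Euclidean and sup norms *)

Section EuclideanNorm.
Variables (R : realType) (n : nat).
Implicit Types x : 'cV[R]_n.

Lemma enorm_ge0 x : 0 <= enorm x.
Proof. exact: sqrtr_ge0. Qed.

Lemma coord_le_enorm x i : `|x i 0| <= enorm x.
Proof.
rewrite /enorm -sqrtr_sqr ler_wsqrtr// (bigD1 i)//= lerDl.
by apply: sumr_ge0 => j _; exact: sqr_ge0.
Qed.

Lemma norm_le_enorm x : `|x| <= enorm x.
Proof. by apply: norm_le_coord; [exact: enorm_ge0|exact: coord_le_enorm]. Qed.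

Lemma enorm_le (M : R) x : 0 <= M -> (forall i, `|x i 0| <= M) -> enorm x <= n.+1%:R * M.
Proof.
move=> M0 xM.
have n0 : (0 : R) <= n.+1%:R * M by rewrite mulr_ge0.
rewrite /enorm -(ger0_norm n0) -sqrtr_sqr ler_wsqrtr//.
apply: (@le_trans _ _ (\sum_(i < n) M ^+ 2)).
  apply: ler_sum => i _; rewrite -(real_normK (num_real (x i 0))).
  by rewrite ler_sqr ?nnegrE.
rewrite sumr_const card_ord -[_ *+ n]mulr_natl exprMn ler_wpM2r ?sqr_ge0//.
by rewrite -natrX ler_nat -mulnn mulSn (leq_trans (leqnSn n))// leq_addr.
Qed.

Lemma enorm_le_norm x : enorm x <= n.+1%:R * `|x|.
Proof. by apply: enorm_le => // i; exact: coord_le_norm. Qed.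

End EuclideanNorm.

(** * Measurability and integrals on the half-line *)

Section HalfLine.
Variable R : realType.
Notation mu := (@lebesgue_measure R).
Implicit Types (h : R -> R) (T : R).

Lemma measurable_halfline h :
  (forall T, 0 <= T -> measurable_fun `[0, T] h) -> measurable_fun (`[0, +oo[ : set R) h.
Proof.
move=> mh.
rewrite (_ : (`[0, +oo[%classic : set R) = \bigcup_N `[0, (N%:R : R)]%classic).
  by apply/measurable_fun_bigcup => // N; exact: mh.
apply/seteqP; split => [x/=|x [N _]/=]; rewrite !in_itv/= ?andbT => x0.
  exists (Num.bound x) => //=; rewrite in_itv/= x0 ltW//.
  by apply: archi_boundP.
by case/andP: x0.
Qed.

Lemma measurable_solution (n : nat) (F : R -> 'cV[R]_n -> 'cV[R]_n) (x0 : 'cV[R]_n)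
    (x : R -> 'cV[R]_n) (q : 'cV[R]_n -> R) :
  is_solution F x0 x -> continuous q -> measurable_fun (`[0, +oo[ : set R) (q \o x).
Proof.
move=> /is_solution_on xs cq; apply: measurable_halfline => T T0.
apply: measurable_continuous_comp => //.
exact: (solution_on_continuous T0 (xs T)).
Qed.

(** Otherwise h >= e on a set of infinite measure. This provides the switching time from finiteness
    of the cost alone. *)
Lemma small_value_of_integrable h (e : R) : measurable_fun (`[0, +oo[ : set R) h ->
  (forall t, 0 <= t -> 0 <= h t) ->
  (\int[mu]_(t in `[0%R, +oo[) (h t)%:E < +oo)%E -> 0 < e ->
  exists T, 0 <= T /\ h T < e.
Proof.
move=> mh h0 hfin e0; apply: contrapT => hn.
have he t : 0 <= t -> e <= h t.
  by move=> t0; rewrite leNgt; apply/negP => het; apply: hn; exists t.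
have : (\int[mu]_(t in `[0%R, +oo[) (cst e%:E) t <= \int[mu]_(t in `[0%R, +oo[) (h t)%:E)%E.
  apply: ge0_le_integral => //.
  - by move=> t _; rewrite lee_fin ltW.
  - by apply/measurable_EFinP.
  - by move=> t; rewrite /= in_itv/= andbT => t0; rewrite lee_fin; exact: he.
have muy : mu `[0%R, +oo[ = +oo%E by rewrite lebesgue_measure_itv/= ltry.
rewrite integral_cst//= muy gt0_muley ?lte_fin//.
by rewrite leye_eq => /eqP hE; rewrite hE ltxx in hfin.
Qed.

Lemma halfline_setU T : 0 <= T ->
  (`[0, +oo[%classic : set R) = `[0, T]%classic `|` `]T, +oo[%classic.
Proof.
move=> T0; apply/seteqP; split => t /=; rewrite !in_itv/= !andbT.
  by move=> ->; have [tT|Tt] := leP t T; [left|right].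
by case=> [/andP[]|/ltW]//; exact: le_trans.
Qed.

Lemma halfline_split h T : 0 <= T -> measurable_fun (`[0, +oo[ : set R) h ->
  (forall t, 0 <= t -> 0 <= h t) ->
  (\int[mu]_(t in `[0%R, +oo[) (h t)%:E =
   \int[mu]_(t in `[0%R, T]) (h t)%:E + \int[mu]_(t in `]T, +oo[) (h t)%:E)%E.
Proof.
move=> T0 mh h0.
have E := halfline_setU T0.
rewrite E ge0_integral_setU//.
- by rewrite -E; apply/measurable_EFinP.
- by move=> t; rewrite -E /= in_itv/= andbT => t0; rewrite lee_fin h0.
- apply/disj_setPS => t [/=]; rewrite !in_itv/= andbT => /andP[_ tT].
  by rewrite ltNge tT.
Qed.

End HalfLine.

Lemma lipschitz_bound_continuous (R : realType) (U W : normedModType R) (L : R) (h : U -> W) :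
  (forall y z, `|h y - h z| <= L * `|y - z|) -> continuous h.
Proof.
move=> lip y; apply/cvgrPdist_le => e e0.
have L1 : 0 < `|L| + 1 by rewrite ltr_pwDr.
near=> z; apply: le_trans (lip _ _) _.
apply: (@le_trans _ _ ((`|L| + 1) * `|y - z|)).
  by rewrite ler_wpM2r// (le_trans (ler_norm L))// lerDl.
rewrite -ler_pdivlMl// mulrC.
near: z; apply: cvgr_dist_le; first exact: cvg_id.
by rewrite divr_gt0.
Unshelve. all: by end_near. Qed.

(** * [Lp] controls and tails with power decay *)

Section LpControls.
Variables (R : realType) (k : nat).
Notation mu := (@lebesgue_measure R).
Implicit Types (u : R -> 'cV[R]_k) (p T : R).

Lemma measurable_enorm (D : set R) u :
  (forall j, measurable_fun D (fun t => u t j 0)) ->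
  measurable_fun D (fun t => enorm (u t)).
Proof.
move=> um; apply: (@measurableT_comp _ _ _ _ _ _ (@Num.sqrt R)).
  by apply: continuous_measurable_fun; exact: sqrt_continuous.
by apply: measurable_sum => j; exact: measurable_funX.
Qed.

Lemma measurable_enorm_powR (D : set R) u p :
  (forall j, measurable_fun D (fun t => u t j 0)) ->
  measurable_fun D (fun t => enorm (u t) `^ p).
Proof.
move=> um; apply: (@measurableT_comp _ _ _ _ _ _ (fun r : R => r `^ p)).
  exact: measurable_powR.
exact: measurable_enorm.
Qed.

Lemma poweR_Lp_norm u p : p != 0 ->
  poweR (Lp_norm p u) p = (\int[mu]_(t in `[0%R, +oo[) (enorm (u t) `^ p)%:E)%E.
Proof.
move=> p0; rewrite /Lp_norm poweR_Lnorm// [RHS]integral_mkcond.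
apply: eq_integral => t _; rewrite !patchE; case: ifP => _.
  by rewrite /= ger0_norm// enorm_ge0.
(* Off the half-line the p-th power of 0 has to vanish, which uses p != 0. *)
by rewrite /= normr0 powR0.
Qed.

Lemma Lp_norm_lty u p : p != 0 ->
  (Lp_norm p u < +oo)%E <->
  (\int[mu]_(t in `[0%R, +oo[) (enorm (u t) `^ p)%:E < +oo)%E.
Proof.
move=> p0; rewrite -poweR_Lp_norm//; split; first exact: poweR_lty.
by case: (Lp_norm p u) => [r||]; rewrite ?ltry ?ltNyr ?poweRyr.
Qed.

(** Domination by 1 + |u|^p, integrable on bounded intervals: the constant covers the times with |u|
    <= 1, and p >= 1 the others. *)
Lemma Lp_sub_L1loc p u : 1 <= p -> Lp p u -> L1loc u.
Proof.
move=> p1 [um up] T T0 j.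
have p0 : p != 0 by rewrite gt_eqF// (lt_le_trans ltr01).
have sub : (`[0, T]%classic : set R) `<=` `[0, +oo[%classic.
  by move=> t /=; rewrite !in_itv/= andbT => /andP[].
have muT i : measurable_fun `[0, T] (fun t => u t i 0).
  by apply: measurable_funS (um i).
have Ep : mu.-integrable `[0, T] (EFin \o (fun t => enorm (u t) `^ p)).
  apply/integrableP; split.
    by apply/measurable_EFinP; exact: measurable_enorm_powR.
  move/(Lp_norm_lty u p0) : up; apply: le_lt_trans.
  apply: (@le_trans _ _ (\int[mu]_(t in `[0%R, T]) (enorm (u t) `^ p)%:E)%E).
    rewrite le_eqVlt; apply/orP; left; apply/eqP.
    by apply: eq_integral => t _; rewrite /= ger0_norm// powR_ge0.
  apply: ge0_subset_integral => //.
    by apply/measurable_EFinP; exact: measurable_enorm_powR.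
  by move=> t _; rewrite lee_fin powR_ge0.
apply: (integrable_dominated (mu := mu) (f := fun t => u t j 0)
  (g := fun t => 1 + enorm (u t) `^ p)) => //.
- exact: muT.
- by apply: integrable_add => //; exact: integrable_cst_itv.
- move=> t _; apply: le_trans (coord_le_enorm (u t) j) _.
have [le1|ge1] := leP (enorm (u t)) 1.
  by apply: le_trans le1 _; rewrite lerDl powR_ge0.
apply: (@le_trans _ _ (enorm (u t) `^ p)); last by rewrite lerDr.
by apply: le1r_powR => //; exact: ltW.
Qed.

Lemma lebesgue_measure_0T T : 0 <= T -> mu `[0, T] = T%:E.
Proof.
rewrite le_eqVlt => /predU1P[<-|T0]; first by rewrite set_itv1 lebesgue_measure_set1.
by rewrite lebesgue_measure_itv/= lte_fin T0 sube0.
Qed.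

(** Used twice: b = alpha p for the norm of the feedback control, b = 2 alpha for the cost of its
    trajectory. *)
Lemma integral_tail_le (h : R -> R) (b T M : R) : 1 < b -> 0 <= M ->
  measurable_fun (`]T, +oo[%classic : set R) h ->
  (forall t, T < t -> 0 <= h t <= M * (t - T + 1) `^ (- b)) ->
  (\int[mu]_(t in `]T, +oo[) (h t)%:E <= (M * (b - 1)^-1)%:E)%E.
Proof.
move=> b1 M0 mh hM.
have mp (D : set R) : measurable_fun D (fun t => (t - T + 1) `^ (- b)).
  apply: (@measurableT_comp _ _ _ _ _ _ (fun r : R => r `^ (- b))).
    exact: measurable_powR.
  by apply: measurable_funD => //; exact: measurable_funB.
apply: (@le_trans _ _
  (\int[mu]_(t in `]T, +oo[) (M%:E * ((t - T + 1) `^ (- b))%:E))%E).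
  apply: ge0_le_integral => //.
  - by move=> t; rewrite /= in_itv/= andbT => /hM /andP[]; rewrite lee_fin.
  - by apply/measurable_EFinP.
  - have : measurable_fun (`]T, +oo[%classic : set R)
        (EFin \o (fun t => M * (t - T + 1) `^ (- b))).
      by apply/measurable_EFinP; exact: measurable_funM.
    exact.
  - by move=> t; rewrite /= in_itv/= andbT => /hM /andP[_]; rewrite lee_fin.
rewrite ge0_integralZl_EFin//.
- rewrite EFinM lee_wpmul2l// -(powR_tail_integral T b1).
  apply: ge0_subset_integral => //.
  + by apply/measurable_EFinP; exact: mp.
  + by move=> t _; rewrite lee_fin powR_ge0.
  + by move=> t /=; rewrite !in_itv/= !andbT => /ltW.
- by move=> t _; rewrite lee_fin powR_ge0.
- by apply/measurable_EFinP; exact: mp.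
Qed.

End LpControls.

(** * Costs, the stabilizing feedback and the near-optimal [Lp] control *)

Section Cost.
Variables (R : realType) (n k : nat) (P : 'M[R]_n).
Variables (f : 'cV[R]_n -> 'cV[R]_n) (g : 'I_k -> 'cV[R]_n -> 'cV[R]_n).
Variable x0 : 'cV[R]_n.
Hypotheses (P_posdef : sym_posdef P).
Hypotheses (f_smooth : smooth_field f) (g_smooth : forall j, smooth_field (g j)).
Notation mu := (@lebesgue_measure R).

Lemma cost_ge0 (u : R -> 'cV[R]_k) : (0 <= cost P f g x0 u)%E.
Proof.
rewrite /cost; case: pselect => [ex|_]; last exact: leey.
by apply: integral_ge0 => t _; rewrite lee_fin; exact: quad_form_ge0.
Qed.

(** Uniqueness up to every time t identifies the trajectory picked by [cid] with any trajectory at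
    hand. *)
Lemma costE (u : R -> 'cV[R]_k) (X : R -> 'cV[R]_n) : L1loc u ->
  is_trajectory f g x0 u X ->
  cost P f g x0 u = (\int[mu]_(t in `[0%R, +oo[) (quad_form P (X t))%:E)%E.
Proof.
move=> ui Xs; rewrite /cost; case: pselect => [ex|]; last first.
  by move=> hn; case: hn; exists X.
apply: eq_integral => t; rewrite inE/= in_itv/= andbT => t0.
have /is_solution_on Ys := projT2 (cid ex).
have /is_solution_on Xs' := Xs.
congr (quad_form P _)%:E.
apply: (control_solution_unique f_smooth g_smooth t0 (ui t t0) (Ys t) (Xs' t)).
by rewrite t0 lexx.
Qed.

Lemma cost_lty (u : R -> 'cV[R]_k) : (cost P f g x0 u < +oo)%E ->
  exists x, is_trajectory f g x0 u x.
Proof. by rewrite /cost; case: pselect => // _; rewrite ltxx. Qed.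

(** Passes from Euclidean to sup norms, at the price of a factor [n.+1] in the decay constant, and
    from a neighborhood to an explicit radius. *)
Lemma stabilizing_feedback (alpha : R) : locally_stabilizable f g alpha ->
  exists (ubar : 'cV[R]_n -> 'cV[R]_k) (L B r : R),
  [/\ 0 <= L, continuous ubar /\ (forall y, `|ubar y| <= L * `|y|), 0 <= B, 0 < r &
    forall y0 : 'cV[R]_n, `|y0| < r -> exists y,
      is_solution (fun _ q => f q + control_mx g q *m ubar q) y0 y /\
      forall t, 0 <= t -> `|y t| <= B * `|y0| * (t + 1) `^ (- alpha)].
Proof.
move=> [ubar [C [[M [Mr hM]] ubar0 /nbhs_ballP[r /= r0 hr]]]].
(* The Lipschitz hypothesis holds for every constant beyond some M; a nonnegative one is taken. *)
pose L := Num.max M 0 + 1.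
have ML : M < L by rewrite ltr_pwDr// le_max lexx.
have L0 : 0 <= L by rewrite addr_ge0// le_max lexx orbT.
have lip (y z : 'cV[R]_n) : `|ubar y - ubar z| <= L * `|y - z|.
  by have := hM L ML (y, z); apply.
exists ubar, L, (`|C| * n.+1%:R), r; split=> //.
- split.
    exact: lipschitz_bound_continuous lip.
  by move=> y; have := lip y 0; rewrite ubar0 !subr0.
move=> y0 yr.
have [|y [ys hy]] := hr y0.
  by rewrite -ball_normE /ball_/= sub0r normrN.
exists y; split=> // t t0.
apply: le_trans (norm_le_enorm _) _; apply: le_trans (hy t t0) _.
rewrite ler_wpM2r ?powR_ge0// -mulrA.
apply: (@le_trans _ _ (`|C| * enorm y0)).
  by rewrite ler_wpM2r ?enorm_ge0// ler_norm.
by rewrite ler_wpM2l// enorm_le_norm.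
Qed.

Lemma half_gt0 (r : R) : 0 < r -> 0 < r / 2.
Proof. by move=> r0; rewrite divr_gt0. Qed.

Lemma small_scale (Q r d : R) : 0 <= Q -> 0 < r -> 0 < d ->
  exists e : R, [/\ 0 < e, e <= r, e <= 1 & Q * e <= d].
Proof.
move=> Q0 r0 d0; have Q1 : 0 < Q + 1 by lra.
exists (Num.min r (Num.min 1 (d / (Q + 1)))); set e := Num.min _ _.
have e0 : 0 < e by rewrite !lt_min r0 ltr01 divr_gt0.
have e2 : e <= d / (Q + 1) by rewrite !ge_min lexx !orbT.
split=> //; [by rewrite ge_min lexx|by rewrite !ge_min lexx orbT|].
rewrite ler_pdivlMr// in e2; nra.
Qed.

(** Half of delta pays for the change of trajectory on [0, T], the other half for the cost after
    T. *)
Lemma near_optimal_Lp_control (alpha p delta : R) (u : R -> 'cV[R]_k) :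
  locally_stabilizable f g alpha ->
  1 <= p -> 1 < 2 * alpha -> 1 < alpha * p -> 0 < delta ->
  L1loc u -> (cost P f g x0 u < +oo)%E ->
  exists v, Lp p v /\ (cost P f g x0 v <= cost P f g x0 u + delta%:E)%E.
Proof.
move=> stab p1 a2 ap delta0 ui cu.
have p0 : 0 < p by apply: lt_le_trans p1.
have [x xs] := cost_lty cu.
have cuE := costE ui xs; rewrite cuE in cu *.
have [ubar [L [B [r [L0 [cubar hubar] B0 r0 feedback]]]]] := stabilizing_feedback stab.
have [c [c0 hc]] := norm_le_quad_form P_posdef.
have K0 := abs_sum_ge0 P; set K := abs_sum P in K0.
have mqx : measurable_fun (`[0, +oo[%classic : set R) (quad_form P \o x).
  by apply: (measurable_solution xs); exact: quad_form_continuous.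
have q0 (y : 'cV[R]_n) : 0 <= quad_form P y by exact: quad_form_ge0.
(* The cost after T will be at most Q |z T|^2: K bounds the form, B the decay, and (2 alpha - 1)^-1
   is the integral of (t + 1)^(-2 alpha). *)
pose Q := K * B ^+ 2 * (2 * alpha - 1)^-1.
have Q0 : 0 <= Q by rewrite !mulr_ge0 ?exprn_ge0// invr_ge0 subr_ge0 ltW.
(* The bound r / 2 puts states of size eta strictly inside the region of stabilization, and eta <= 1
   turns the linear bound Q eta <= delta / 2 into the quadratic one. *)
have [eta [eta0 eta_r2 eta1 etaQ1]] := small_scale Q0 (half_gt0 r0) (half_gt0 delta0).
have eta0' := ltW eta0.
have eta_r : eta < r.
  by apply: le_lt_trans eta_r2 _; rewrite ltr_pdivrMr// ltr_pMr// ltr1n.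
have etaQ : Q * eta ^+ 2 <= delta / 2.
  by apply: le_trans etaQ1; rewrite ler_wpM2l// expr2 ler_piMl.
have [T [T0 qT]] : exists T, 0 <= T /\ quad_form P (x T) < (eta / 2) ^+ 2 / c.
  apply: (@small_value_of_integrable R (quad_form P \o x)) => //.
    by move=> t _; exact: q0.
  by rewrite divr_gt0// exprn_gt0// divr_gt0.
have TT : 0 <= T <= T by rewrite T0 lexx.
have xT : `|x T| <= eta / 2.
  rewrite -ler_sqr ?nnegrE ?normr_ge0//; last by rewrite divr_ge0.
  apply: le_trans (hc (x T)) _.
  by rewrite mulrC -ler_pdivlMr// ltW.
have /is_solution_on/(_ T) xsT := xs.
have [rho [rho0 hx]] := within_continuous_bounded (solution_on_continuous T0 xsT).
(* A Lipschitz constant of the form on the ball of radius rho + 1. The closeness e is chosen so that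
   K2 e T <= delta / 2 and, with e <= eta / 2, so that |z T| <= eta. *)
pose K2 := K * (2 * (rho + 1)).
have K20 : 0 <= K2 by rewrite mulr_ge0// mulr_ge0// addr_ge0.
have TK : 0 <= K2 * T by rewrite mulr_ge0.
have [e [e0 e_eta e1 eT]] := small_scale TK (half_gt0 eta0) (half_gt0 delta0).
rewrite mulrAC in eT.
have [w [N [z [mw hw zs zx]]]] :=
  bounded_control_approx f_smooth g_smooth T0 e0 (ui T T0) xsT.
have zT : `|z T| <= eta.
  rewrite -[z T](subrK (x T)); apply: le_trans (ler_normD _ _) _.
  by have := zx T TT; lra.
have [y [ys hy]] := feedback (z T) (le_lt_trans zT eta_r).
pose v t : 'cV[R]_k := if t <= T then w t else ubar (y (t - T)).
pose X t : 'cV[R]_n := if t <= T then z t else y (t - T).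
have Xs : is_trajectory f g x0 v X.
  (* Closed loop after T; along X this is the open-loop system driven by v. *)
  pose G t q := if t <= T then dynamics f g w t q else f q + control_mx g q *m ubar q.
  have GX : is_solution G x0 X.
    apply: (@solution_concat _ _ T (dynamics f g w) G
      (fun q => f q + control_mx g q *m ubar q)) => //.
    - by move=> s q sT; rewrite /G sT.
    - by move=> s q Ts; rewrite /G leNgt Ts.
  have E s : G s (X s) = dynamics f g v s (X s).
    by rewrite /G /X /dynamics /v; case: (leP s T).
  move=> t t0 i; have [Gi GE] := GX t t0 i.
  have Ei s : G s (X s) i 0 = dynamics f g v s (X s) i 0.
    by rewrite E.
  split; first by apply: eq_integrable Gi => // s _; rewrite Ei.
  by rewrite GE; congr (_ + _); apply: eq_Rintegral => s _; rewrite Ei.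
have split_set : (`[0, +oo[%classic : set R) = `[0, T]%classic `|` `]T, +oo[%classic.
  exact: halfline_setU.
have cy : forall T', 0 <= T' -> {within `[0, T'], continuous y}.
  move=> T' T'0; have /is_solution_on/(_ T') ysT := ys.
  exact: solution_on_continuous T'0 ysT.
have m_shift (h : 'cV[R]_n -> R) : continuous h ->
    measurable_fun (`]T, +oo[%classic : set R) (fun t => h (y (t - T))).
  move=> ch.
  have mhy : measurable_fun (`[0, +oo[%classic : set R) (h \o y).
    apply: measurable_halfline => T' T'0.
    by apply: measurable_continuous_comp => //; exact: cy.
  apply: (@measurable_comp _ _ _ R R R (`[0, +oo[%classic) (h \o y)
    (`]T, +oo[%classic) (fun t => t - T)) => //.
    by move=> _ [t /=] + <-; rewrite !in_itv/= !andbT subr_ge0 => /ltW.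
  exact: measurable_funB.
have mv j : measurable_fun (`[0, +oo[%classic : set R) (fun t => v t j 0).
  rewrite split_set; apply/measurable_funU => //; split.
    apply: eq_measurable_fun (mw j) => t; rewrite inE/= in_itv/= => /andP[_ tT].
    by rewrite /v tT.
  apply: eq_measurable_fun (m_shift (fun q => ubar q j 0) _).
    by move=> t; rewrite inE/= in_itv/= andbT => Tt; rewrite /v leNgt Tt.
  exact: continuous_coord.
pose s := `|z T|.
have s0 : 0 <= s by exact: normr_ge0.
have ytail t : T < t -> `|y (t - T)| <= B * s * (t - T + 1) `^ (- alpha).
  by move=> Tt; apply: hy; rewrite subr_ge0 ltW.
have vLp : Lp p v.
  split=> //; apply/Lp_norm_lty; first by rewrite gt_eqF.
  rewrite (halfline_split T0); last 2 first.
  - exact: measurable_enorm_powR.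
  - by move=> t _; exact: powR_ge0.
  (* The absolute value is taken because a bound on the coordinates says nothing about the sign of
     [N] when k = 0. *)
  pose M1 := (k.+1%:R * `|N|) `^ p.
  pose M2 := (k.+1%:R * (L * (B * s))) `^ p.
  apply: (@le_lt_trans _ _ ((M1 * T)%:E + (M2 * (alpha * p - 1)^-1)%:E)%E); last first.
    by rewrite -EFinD ltry.
  apply: leeD.
    rewrite EFinM -(lebesgue_measure_0T T0) -integral_cst//.
    apply: ge0_le_integral => //.
    - by move=> t _; rewrite lee_fin powR_ge0.
    - apply/measurable_EFinP; apply: measurable_enorm_powR => j.
      by apply: measurable_funS (mv j) => //; rewrite split_set; exact: subsetUl.
    - move=> t; rewrite /= in_itv/= => /andP[_ tT]; rewrite lee_fin /v tT.
      apply: (ge0_ler_powR (ltW p0)); rewrite ?nnegrE ?enorm_ge0 ?mulr_ge0//.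
      apply: enorm_le => // j; apply: le_trans (hw t j) _; exact: ler_norm.
  apply: integral_tail_le => //; first exact: powR_ge0.
    apply: measurable_enorm_powR => j.
    by apply: measurable_funS (mv j) => //; rewrite split_set; exact: subsetUr.
  move=> t Tt; have tTf : (t <= T) = false by rewrite leNgt Tt.
  rewrite powR_ge0/= /v tTf.
  rewrite -mulNr powRrM /M2 -powRM ?powR_ge0 ?mulr_ge0//.
  apply: (ge0_ler_powR (ltW p0)); rewrite ?nnegrE ?enorm_ge0 ?mulr_ge0 ?powR_ge0//.
  apply: le_trans (enorm_le_norm _) _; rewrite -!mulrA ler_wpM2l//.
  apply: le_trans (hubar _) _; rewrite ler_wpM2l//.
  by rewrite mulrA; exact: ytail.
exists v; split=> //.
rewrite (costE (Lp_sub_L1loc p1 vLp) Xs).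
have mX : measurable_fun (`[0, +oo[%classic : set R) (quad_form P \o X).
  by apply: (measurable_solution Xs); exact: quad_form_continuous.
rewrite (halfline_split T0 mX); last by move=> t _; exact: q0.
have qx_T : (\int[mu]_(t in `[0%R, T]) (quad_form P (x t))%:E <=
    \int[mu]_(t in `[0%R, +oo[) (quad_form P (x t))%:E)%E.
  apply: ge0_subset_integral => //.
  - exact/measurable_EFinP.
  - by move=> t _; rewrite lee_fin.
  - by rewrite split_set; exact: subsetUl.
have mqxT : measurable_fun `[0, T] (quad_form P \o x).
  by apply: measurable_funS mqx => //; rewrite split_set; exact: subsetUl.
have head : (\int[mu]_(t in `[0%R, T]) (quad_form P (X t))%:E <=
    \int[mu]_(t in `[0%R, +oo[) (quad_form P (x t))%:E + (delta / 2)%:E)%E.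
  apply: (@le_trans _ _ (\int[mu]_(t in `[0%R, T])
      ((quad_form P (x t))%:E + (cst (K2 * e)%:E) t))%E).
    apply: ge0_le_integral => //.
    - by move=> t _; rewrite lee_fin.
    - apply/measurable_EFinP.
      by apply: measurable_funS mX => //; rewrite split_set; exact: subsetUl.
    - have : measurable_fun `[0, T] (EFin \o (fun t => quad_form P (x t) + K2 * e)).
        by apply/measurable_EFinP; exact: measurable_funD.
      exact.
    - move=> t; rewrite /= in_itv/= => tT; rewrite -EFinD lee_fin.
      have /andP[_ tleT] := tT; rewrite /X tleT.
      have xr : `|x t| <= rho + 1 by have := hx t tT; lra.
      have zr : `|z t| <= rho + 1.
        rewrite -[z t](subrK (x t)); apply: le_trans (ler_normD _ _) _.
        by have := zx t tT; have := hx t tT; lra.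
      apply: le_trans (quad_form_lipschitz P zr xr) _.
      rewrite lerD2l -/K mulrA -/K2.
      by apply: ler_wpM2l => //; exact: zx.
  rewrite ge0_integralD//; last 3 first.
  - by move=> t _; rewrite lee_fin.
  - exact/measurable_EFinP.
  - by move=> t _; rewrite lee_fin mulr_ge0// ltW.
  rewrite integral_cst//= lebesgue_measure_0T// -EFinM.
  by apply: leeD => //; rewrite lee_fin.
have tail : (\int[mu]_(t in `]T, +oo[) (quad_form P (X t))%:E <= (delta / 2)%:E)%E.
  apply: (@le_trans _ _ (K * (B * s) ^+ 2 * (2 * alpha - 1)^-1)%:E).
    apply: integral_tail_le => //.
    - by rewrite mulr_ge0// sqr_ge0.
    - by apply: measurable_funS mX => //; rewrite split_set; exact: subsetUr.
    move=> t Tt; have tTf : (t <= T) = false by rewrite leNgt Tt.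
    rewrite q0/= /X tTf.
    apply: le_trans (quad_form_le P _) _; rewrite -mulrA ler_wpM2l//.
    rewrite -mulrN [2 * _]mulrC powRrM powR_mulrn ?powR_ge0// -exprMn.
    by rewrite ler_sqr ?nnegrE ?mulr_ge0 ?powR_ge0//; exact: ytail.
  rewrite lee_fin; apply: le_trans etaQ.
  rewrite exprMn mulrA mulrAC -/Q; apply: ler_wpM2l => //.
  by rewrite ler_sqr ?nnegrE.
apply: (le_trans (leeD head tail)).
rewrite -addeA -EFinD; apply: leeD => //.
by rewrite lee_fin; lra.
Qed.

End Cost.

(** * Convergence of the regularized infima *)

Theorem corollary2p6 (R : realType) (n k : nat) (P : 'M[R]_n)
    (f : 'cV[R]_n -> 'cV[R]_n) (g : 'I_k -> 'cV[R]_n -> 'cV[R]_n)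
    (x0 : 'cV[R]_n) (p alpha : R)
    (P_posdef : sym_posdef P)
    (f_smooth : smooth_field f) (g_smooth : forall j, smooth_field (g j))
    (p_alpha : (1 <= p < 2) /\ p^-1 < alpha \/ 2 <= p /\ 2^-1 < alpha)
    (stab : locally_stabilizable f g alpha) :
  ereal_inf [set (cost P f g x0 u + eps%:E * poweR (Lp_norm p u) p)%E
              | u in @Lp R k p] @[eps --> 0^'+]
    --> ereal_inf [set cost P f g x0 u | u in @L1loc R k].
Proof.
(* Both regimes reduce to the same two inequalities: for p < 2, alpha > 1/p > 1/2 gives both; for p
   >= 2, alpha p >= 2 alpha > 1. *)
have [p1 a2 ap] : [/\ 1 <= p, 1 < 2 * alpha & 1 < alpha * p].
  case: p_alpha => [[/andP[p1 p2] pa]|[p2 a2]].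
    have pp : 0 < p by lra.
    have ap : 1 < alpha * p by rewrite -ltr_pdivrMr// mul1r.
    by split=> //; nra.
  have h : 1 < 2 * alpha by lra.
  by split=> //; [lra|nra].
have p0 : p != 0 by rewrite gt_eqF// (lt_le_trans ltr01).
set V0 := ereal_inf [set cost P f g x0 u | u in @L1loc R k].
set V := fun eps : R => ereal_inf _.
have V0_le u : L1loc u -> (V0 <= cost P f g x0 u)%E.
  by move=> ui; apply: ereal_inf_lbound; exists u.
have V_ge eps : 0 < eps -> (V0 <= V eps)%E.
  move=> eps0; apply: le_ereal_inf_tmp => _ [u up <-].
  apply: le_trans (V0_le u (Lp_sub_L1loc p1 up)) _.
  by apply: leeDl; apply: mule_ge0; [rewrite lee_fin ltW|exact: poweR_ge0].
have V00 : (0 <= V0)%E.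
  by apply: le_ereal_inf_tmp => _ [u _ <-]; exact: cost_ge0.
(* If every locally integrable control has infinite cost, the regularized infima are constantly +oo
   for eps > 0. *)
have [V0y|V0fin] := eqVneq V0 +oo%E.
  rewrite V0y; apply: cvg_near_cst; near=> eps.
  have eps0 : 0 < eps by near: eps; exact: nbhs_right_gt.
  by have := V_ge eps eps0; rewrite V0y leye_eq => /eqP.
have [r V0r] : exists r : R, V0 = r%:E.
  by exists (fine V0); rewrite fineK// ge0_fin_numE// ltey.
(* The error e is split into thirds: a nearly optimal [u], its replacement [v] in [Lp], and the
   penalty eps a. As [v] is fixed before eps, the penalty can be made small. *)
have key (e : R) : 0 < e -> \forall eps \near (0 : R)^'+, (r%:E <= V eps <= (r + e)%:E)%E.
  move=> e0.
  have [u [ui cu]] : exists u, L1loc u /\ (cost P f g x0 u < (r + e / 3)%:E)%E.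
    have := @lb_ereal_inf_adherent R [set cost P f g x0 u | u in @L1loc R k] (e / 3).
    have e3 : 0 < e / 3 by lra.
    rewrite -/V0 V0r => /(_ e3 isT) [_ [u ui <-] cu].
    by exists u; split=> //; rewrite EFinD.
  have cuy : (cost P f g x0 u < +oo)%E by apply: lt_trans cu _; rewrite ltry.
  have e3 : 0 < e / 3 by lra.
  have [v [vp cv]] := near_optimal_Lp_control P_posdef f_smooth g_smooth
    stab p1 a2 ap e3 ui cuy.
  have cv' : (cost P f g x0 v <= (r + e / 3 + e / 3)%:E)%E.
    by apply: le_trans cv _; rewrite [leRHS]EFinD leeD2r// ltW.
  pose a := fine (poweR (Lp_norm p v) p).
  have aE : poweR (Lp_norm p v) p = a%:E.
    by rewrite /a fineK// ge0_fin_numE ?poweR_ge0// poweR_lty//; case: vp.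
  have a0 : 0 <= a by rewrite /a fine_ge0// poweR_ge0.
  have a1 : 0 < 3 * (a + 1) by lra.
  near=> eps.
  have eps0 : 0 < eps by near: eps; exact: nbhs_right_gt.
  have epsa : eps <= e / (3 * (a + 1)).
    by near: eps; apply: nbhs_right_le; rewrite divr_gt0.
  rewrite -V0r V_ge//=.
  apply: (@le_trans _ _ (cost P f g x0 v + eps%:E * poweR (Lp_norm p v) p)%E).
    by apply: ereal_inf_lbound; exists v.
  rewrite aE -EFinM.
  apply: le_trans (leeD cv' (lexx _)) _; rewrite -EFinD lee_fin.
  by rewrite ler_pdivlMr// in epsa; nra.
(* Convergence to a finite limit in the extended reals: eventual finiteness, from [key] at 1, then
   real distances. *)
rewrite V0r; apply/fine_cvgP; split.
  near=> eps.
  have /andP[h1 h2] : (r%:E <= V eps <= (r + 1)%:E)%E.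
    by near: eps; exact: key.
  by rewrite fin_numElt (lt_le_trans _ h1) ?ltNyr//= (le_lt_trans h2) ?ltry.
apply/cvgrPdist_le => e e0; near=> eps.
have /andP[h1 h2] : (r%:E <= V eps <= (r + e)%:E)%E.
  by near: eps; exact: key.
move: h1 h2; rewrite /=; case: (V eps) => [t||]//; rewrite !lee_fin => h1 h2.
by rewrite distrC ger0_norm ?subr_ge0//= lerBlDl.
Unshelve. all: by end_near. Qed.
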